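(* Let $V$ be a nonlocal vertex $\mathbb{F}((t))$-algebra such that $V$ as a $V$-module is irreducible with $\mathrm{End}_V(V^{\mathrm{mod}})=\mathbb{F}((t))$. Then $V$ is non-degenerate.
   Context: $\mathbb{F}$ is a field of characteristic $0$; $t,x,x_0,x_1,\dots$ are commuting formal variables. $V((x))$ is the space of lower truncated Laurent series. $\mathbb{F}_*(x_1,\dots,x_r)$ is the localization of $\mathbb{F}[[x_1,\dots,x_r]]$ at the nonzero polynomials; $\iota_{x_{i_1},\dots,x_{i_r}}:\mathbb{F}_*(x_1,\dots,x_r)\to\mathbb{F}((x_{i_1}))\cdots((x_{i_r}))$ is the unique algebra embedding extending the identity of $\mathbb{F}[[x_1,\dots,x_r]]$. Powers of $x_0+x_2$ are expanded in nonnegative powers of the second variable; $f(t+x)=e^{x\,d/dt}f(t)$; for $f\in\mathbb{F}_*(x_1,\dots,x_n)$, $f(t+x_1,\dots,t+x_n)=e^{t(\partial_{x_1}+\cdots+\partial_{x_n})}f\in\mathbb{F}_*(t,x_1,\dots,x_n)$. Nonlocal vertex algebra over $\mathbb{F}$: a vector space $V$ with a linear map $Y(\cdot,x):V\to\mathrm{Hom}(V,V((x)))$, $Y(v,x)=\sum_{n\in\mathbb{Z}}v_nx^{-n-1}$, and $\mathbf{1}\in V$ with $Y(\mathbf{1},x)v=v$, $Y(v,x)\mathbf{1}\in V[[x]]$, $\lim_{x\to0}Y(v,x)\mathbf{1}=v$, and for all $u,v,w\in V$ there is $l\in\mathbb{N}$ with $(x_0+x_2)^lY(u,x_0+x_2)Y(v,x_2)w=(x_0+x_2)^lY(Y(u,x_0)v,x_2)w$.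 Nonlocal vertex $\mathbb{F}((t))$-algebra: a nonlocal vertex algebra over $\mathbb{F}$ which is also an $\mathbb{F}((t))$-module with $Y(f(t)u,x)(g(t)v)=f(t+x)g(t)Y(u,x)v$ for $f,g\in\mathbb{F}((t))$. $V^{\mathrm{mod}}$ is the adjoint module $V$; submodules are $\mathbb{F}$-subspaces stable under all $v_n$ ($v\in V,n\in\mathbb{Z}$) (these are automatically $\mathbb{F}((t))$-submodules), and $\mathrm{End}_V(V^{\mathrm{mod}})$ is the algebra of $\mathbb{F}$-linear endomorphisms of $V$ commuting with all $v_n$ (these are automatically $\mathbb{F}((t))$-linear); $\mathrm{End}_V(V^{\mathrm{mod}})=\mathbb{F}((t))$ means that all of them are multiplications by elements of $\mathbb{F}((t))$. Non-degeneracy: $V^{\otimes n}\boxtimes\mathbb{F}_*(x_1,\dots,x_n)$ is the quotient of $V^{\otimes n}\otimes\mathbb{F}_*(x_1,\dots,x_n)$ (tensor products over $\mathbb{F}$) by the relations $f_1(t)v^{(1)}\otimes\cdots\otimes f_n(t)v^{(n)}\otimes f=v^{(1)}\otimes\cdots\otimes v^{(n)}\otimes f_1(x_1)\cdots f_n(x_n)f$, $f_i(t)\in\mathbb{F}((t))$. $V$ is non-degenerate if for every $n\ge1$ the $\mathbb{F}$-linear map $Z_n:V^{\otimes n}\boxtimes\mathbb{F}_*(x_1,\dots,x_n)\to V((x_1))\cdots((x_n))$, $(v^{(1)}\otimes\cdots\otimes v^{(n)})\boxtimes f\mapsto\iota_{t,x_1,\dots,x_n}f(t+x_1,\dots,t+x_n)Y(v^{(1)},x_1)\cdots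 Y(v^{(n)},x_n)\mathbf{1}$, is injective. *)

(* Defs.v *)
From HB Require Import structures.
From mathcomp Require Import all_boot all_order all_algebra.
From mathcomp Require Import boolp classical_sets functions cardinality fsbigop.
From mathcomp Require Import freeg mpoly.
From mathcomp Require Import zify ring lra.

Set Implicit Arguments.
Unset Strict Implicit.
Unset Printing Implicit Defensive.

Import Order.TTheory GRing.Theory Num.Theory.

Local Open Scope classical_set_scope.
Local Open Scope ring_scope.
Local Open Scope quotient_scope.

Lemma fsum_seq (I : choiceType) (M : zmodType) (s : seq I) (F : I -> M) :
  uniq s -> (forall i, i \notin s -> F i = 0) ->
  \sum_(i \in [set: I]) F i = \sum_(i <- s) F i.
Proof.
move=> us F0; rewrite [RHS]fsbig_seq // -(fsbig_widen [set` s] [set: I]) //.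
by move=> i [_ /negP]; apply: F0.
Qed.

Section LaurentZmod.
Variable M : zmodType.

Definition lower_truncated : {pred int -> M} :=
  [pred f | `[< exists N : int, forall n, n < N -> f n = 0 >]].

Record laurent := Laurent { lcoef :> int -> M; _ : lcoef \in lower_truncated }.
HB.instance Definition _ := [isSub for lcoef].
HB.instance Definition _ := [Choice of laurent by <:].

Lemma lower_truncated_zmod : zmod_closed lower_truncated.
Proof.
split=> [|f g /asboolP[N fN] /asboolP[P gP]]; apply/asboolP; first by exists 0.
exists (Num.min N P) => n; rewrite lt_min => /andP[nN nP].
by rewrite -[LHS]/(f n - g n) fN ?gP ?subr0.
Qed.
HB.instance Definition _ := GRing.isZmodClosed.Build _ lower_truncated
  lower_truncated_zmod.
HB.instance Definition _ := [SubChoice_isSubZmodule of laurent by <:].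

Lemma lcoefP (f g : laurent) : (forall n, f n = g n) -> f = g.
Proof. by move=> fg; apply/val_inj/funext. Qed.

Lemma lcoefD (f g : laurent) n : (f + g) n = f n + g n. Proof. by []. Qed.
Lemma lcoefN (f : laurent) n : (- f) n = - f n. Proof. by []. Qed.
Lemma lcoef0 n : (0 : laurent) n = 0. Proof. by []. Qed.

Lemma lbound (f : laurent) : exists N : int, forall n, n < N -> f n = 0.
Proof. exact/asboolP/(valP f). Qed.

Lemma lconst_subproof (c : M) :
  (fun n : int => if n == 0 then c else 0) \in lower_truncated.
Proof. by apply/asboolP; exists 0 => n; case: ltgtP. Qed.
Definition lconst (c : M) : laurent := Laurent (lconst_subproof c).

Lemma lconst_is_additive : zmod_morphism lconst.
Proof.
move=> a b; apply: lcoefP => n; rewrite lcoefD lcoefN /=.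
by case: eqP; rewrite ?subr0.
Qed.
HB.instance Definition _ := GRing.isZmodMorphism.Build _ _ lconst
  lconst_is_additive.

End LaurentZmod.

Section LaurentScale.
Variables (R : comNzRingType) (M : lmodType R).
Implicit Types (f g : laurent R) (m : laurent M).

Definition lscale_coef f m (n : int) : M :=
  \sum_(i \in [set: int]) f i *: m (n - i).

Lemma lscale_coefE (N : int) (K : nat) f m (n : int) :
    (forall i, i < N -> f i = 0) -> (forall j, j <= n - N - K%:Z -> m j = 0) ->
  lscale_coef f m n = \sum_(k < K) f (N + k%:Z) *: m (n - N - k%:Z).
Proof.
move=> fN mK; rewrite /lscale_coef (@fsum_seq _ _ [seq N + k%:Z | k <- iota 0 K]).
- rewrite big_map -[K in iota 0 K]subn0 -/(index_iota 0 K) big_mkord.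
  by apply: eq_bigr => k _; rewrite opprD addrA.
- by rewrite map_inj_uniq ?iota_uniq // => i j /addrI [].
move=> i /mapP iN; have [/fN->|Ni] := ltP i N; first by rewrite scale0r.
rewrite [m _]mK ?scaler0 //; case: (leP i (N + K%:Z - 1)) => [iK|]; last lia.
by case: iN; exists (absz (i - N)%R); [rewrite mem_iota|]; lia.
Qed.

Lemma lscale_coef_low (N P : int) f m (n : int) :
    (forall i, i < N -> f i = 0) -> (forall j, j < P -> m j = 0) ->
  n < N + P -> lscale_coef f m n = 0.
Proof.
move=> fN mP nNP; rewrite (@lscale_coefE N 0) ?big_ord0 // => j jn.
by apply: mP; lia.
Qed.

Lemma lscale_subproof f m : lscale_coef f m \in @lower_truncated M.
Proof.
have [[N fN] [P mP]] := (lbound f, lbound m).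
by apply/asboolP; exists (N + P) => n; apply: lscale_coef_low.
Qed.
Definition lscale f m : laurent M := Laurent (lscale_subproof f m).

Lemma lscaleDr f : {morph lscale f : m m' / m + m'}.
Proof.
move=> m m'; apply: lcoefP => n; rewrite lcoefD /=.
have [[N fN] [P mP] [P' mP']] := And3 (lbound f) (lbound m) (lbound m').
pose K := (absz (n - N - P)%R + absz (n - N - P')%R).+1.
rewrite !(@lscale_coefE N K) // -?big_split /=.
- by apply: eq_bigr => k _; rewrite -scalerDr.
- by move=> j jn; apply: mP'; lia.
- by move=> j jn; apply: mP; lia.
by move=> j jn; rewrite -[LHS]/(m j + m' j) mP ?mP' ?addr0 //; lia.
Qed.

Lemma lscaleDl m : {morph lscale^~ m : f g / f + g}.
Proof.
move=> f g; apply: lcoefP => n; rewrite lcoefD /=.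
have [[N0 fN0] [N1 gN1] [P mP]] := And3 (lbound f) (lbound g) (lbound m).
pose N := Num.min N0 N1.
have fN i : i < N -> f i = 0 by rewrite lt_min => /andP[? _]; apply: fN0.
have gN i : i < N -> g i = 0 by rewrite lt_min => /andP[_ ?]; apply: gN1.
pose K := (absz (n - N - P)%R).+1.
have mK j : j <= n - N - K%:Z -> m j = 0 by move=> jn; apply: mP; lia.
rewrite !(@lscale_coefE N K) // -?big_split /=.
  by apply: eq_bigr => k _; rewrite -scalerDl.
by move=> i iN; rewrite -[LHS]/(f i + g i) fN ?gN ?addr0.
Qed.

Lemma lscale_const (c : R) m n : lscale (lconst c) m n = c *: m n.
Proof.
rewrite /= /lscale_coef (@fsum_seq _ _ [:: 0]) // ?big_seq1 ?subr0 //.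
by move=> i; rewrite inE /= => /negPf->; rewrite scale0r.
Qed.

End LaurentScale.

Lemma lscale_assoc (R : comNzRingType) (M : lmodType R)
    (a b : laurent R) (m : laurent M) :
  lscale a (lscale b m) = lscale (lscale (M := R^o) a b : laurent R) m.
Proof.
apply: lcoefP => n /=.
have [[A aA] [B bB] [C mC]] := And3 (lbound a) (lbound b) (lbound m).
pose K := (absz (n - A - B - C)%R).+1.
rewrite (@lscale_coefE _ _ A K) //; last first.
  by move=> j jn; apply: (@lscale_coef_low _ _ B C) => //; lia.
rewrite (@lscale_coefE _ _ (A + B) K); last first.
- by move=> j jn; apply: mC; lia.
- by move=> i iAB; apply: (@lscale_coef_low _ R^o A B).
under eq_bigr => i _.
  rewrite /= (@lscale_coefE _ _ B K) //; last by move=> j jn; apply: mC; lia.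
  over.
under [RHS]eq_bigr => k _.
  rewrite /= (@lscale_coefE _ _ A K) //; last first.
    by have := ltn_ord k; move=> kK j jn; apply: bB; lia.
  rewrite scaler_suml; over.
rewrite exchange_big /=; apply: eq_bigr => i _.
pose G (k : nat) := a (A + i%:Z) *: (b (B + k%:Z - i%:Z) *: m (n - A - B - k%:Z)).
have GK k : (K <= k)%N -> G k = 0.
  by move=> Kk; rewrite /G [m _]mC ?scaler0 //; lia.
have Gi k : (k < i)%N -> G k = 0.
  by move=> ki; rewrite /G [b _]bB ?scale0r ?scaler0 //; lia.
rewrite scaler_sumr; transitivity (\sum_(k < K) G (i + k)%N).
  apply: eq_bigr => k _; rewrite /G; congr (_ *: (b _ *: m _)); lia.
transitivity (\sum_(k < K) G k); last first.
  apply: eq_bigr => k _; rewrite /G scalerA; congr (_ * b _ *: m _); lia.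
rewrite -(big_mkord xpredT G) (big_cat_nat (n := i)) //=; last exact/ltnW.
rewrite [X in _ = X + _]big_nat_cond [X in _ = X + _]big1 ?add0r; last first.
  by move=> k /andP[/andP[_ ki] _]; apply: Gi.
rewrite -(big_mkord xpredT (fun k => G (i + k)%N)).
rewrite (big_cat_nat (n := (K - i)%N)) ?leq_subr //=.
rewrite [X in _ + X = _]big_nat_cond [X in _ + X = _]big1 ?addr0; last first.
  by move=> k /andP[/andP[Kik _] _]; apply: GK; rewrite -leq_subLR.
rewrite -[in RHS](add0n i) big_addn; apply: eq_bigr => k _; congr G; exact: addnC.
Qed.

Section LaurentRing.
Variable R : comNzRingType.
Implicit Types f g h : laurent R.

Definition lmul f g : laurent R := lscale (M := R^o) f g.

Lemma lmul_coef f g n : lmul f g n = \sum_(i \in [set: int]) f i * g (n - i).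
Proof. by []. Qed.

Lemma lmulC : commutative lmul.
Proof.
move=> f g; apply: lcoefP => n; rewrite !lmul_coef.
rewrite (reindex_fsbigT (fun i : int => n - i)) //=.
  by apply: eq_fsbigr => i _; rewrite opprB addrCA subrr addr0 mulrC.
by exists (fun i : int => n - i) => i; lia.
Qed.

Lemma lmulA : associative lmul.
Proof. by move=> f g h; apply: (@lscale_assoc R R^o). Qed.

Lemma lmul1 : left_id (lconst (1 : R)) lmul.
Proof. by move=> f; apply: lcoefP => n; rewrite (lscale_const (M := R^o)) scale1r. Qed.

Lemma lmulDl : left_distributive lmul +%R.
Proof. by move=> f g h; apply: (@lscaleDl R R^o). Qed.

Lemma lone_neq0 : lconst (1 : R) != 0.
Proof.
apply/eqP => /(congr1 (fun f : laurent R => f 0)) /= /eqP.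
by rewrite (negPf (oner_neq0 R)).
Qed.

HB.instance Definition _ := GRing.Zmodule_isComNzRing.Build (laurent R)
  lmulA lmulC lmul1 lmulDl lone_neq0.

Lemma lcoefM f g n : (f * g) n = \sum_(i \in [set: int]) f i * g (n - i).
Proof. by []. Qed.

Lemma lconst_is_monoid_morphism : monoid_morphism (@lconst R).
Proof.
split=> // a b; apply: lcoefP => n.
by rewrite [RHS](lscale_const (M := R^o)) /=; case: eqP; rewrite ?scaler0.
Qed.
HB.instance Definition _ := GRing.isMonoidMorphism.Build _ _ (@lconst R)
  lconst_is_monoid_morphism.

End LaurentRing.

(* The scalars of the canonical module structure on [M((x))] are those of  *)
(* [R((x))]; [a : R] acts as [lconst a].                                    *)
Section LaurentModule.
Variables (R : comNzRingType) (M : lmodType R).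

Lemma lscaleA (a b : laurent R) (m : laurent M) :
  lscale a (lscale b m) = lscale (a * b) m.
Proof. exact: lscale_assoc. Qed.

Lemma lscale1 : left_id 1 (@lscale R M).
Proof. by move=> m; apply: lcoefP => n; rewrite lscale_const scale1r. Qed.

HB.instance Definition _ := GRing.Zmodule_isLmodule.Build (laurent R) (laurent M)
  lscaleA lscale1 (@lscaleDr R M) (@lscaleDl R M).

Lemma lcoefZ (f : laurent R) (m : laurent M) n :
  (f *: m) n = \sum_(i \in [set: int]) f i *: m (n - i).
Proof. by []. Qed.

End LaurentModule.

Section PowerSeriesInverse.
Variables (K : fieldType) (a : nat -> K).

Fixpoint ps_inv_seq n : seq K :=
  if n is p.+1 then
    let s := ps_inv_seq p in
    rcons s ((a 0%N)^-1 * ((p == 0%N)%:R - \sum_(i < p) a (p - i)%N * s`_i))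
  else [::].

Definition ps_inv n : K := (ps_inv_seq n.+1)`_n.

Lemma size_ps_inv_seq n : size (ps_inv_seq n) = n.
Proof. by elim: n => //= n IHn; rewrite size_rcons IHn. Qed.

Lemma nth_ps_inv_seq n i : (i < n)%N -> (ps_inv_seq n)`_i = ps_inv i.
Proof.
elim: n => // n IHn; rewrite ltnS leq_eqVlt => /predU1P[->//|lt_in].
by rewrite /= nth_rcons size_ps_inv_seq lt_in IHn.
Qed.

Lemma ps_invP n : a 0%N != 0 ->
  \sum_(k < n.+1) a k * ps_inv (n - k)%N = (n == 0%N)%:R.
Proof.
move=> a0; rewrite big_ord_recl subn0 /ps_inv /= nth_rcons size_ps_inv_seq ltnn.
rewrite eqxx mulrA mulfV // mul1r [X in _ - X](reindex_inj rev_ord_inj) /=.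
apply/eqP; rewrite addrAC subr_eq; apply/eqP; congr (_ + _).
apply: eq_bigr => i _; rewrite /bump /= add1n nth_ps_inv_seq ?subKn //.
by rewrite ltn_subrL /= (leq_trans _ (ltn_ord i)).
Qed.

End PowerSeriesInverse.

Section LaurentField.
Variable K : fieldType.
Implicit Type f : laurent K.

Lemma lvaluation f : f != 0 ->
  exists2 N : int, f N != 0 & forall n, n < N -> f n = 0.
Proof.
move=> f0; have [N fN] := lbound f.
have exk : exists k : nat, f (N + k%:Z) != 0.
  apply: contrapT => nok; case/eqP: f0; apply: lcoefP => n.
  rewrite lcoef0; have [/fN//|Nn] := ltP n N; apply: contrapT => /eqP fn; case: nok.
  exists (absz (n - N)%R); have -> : N + (absz (n - N)%R)%:Z = n by lia.
  exact: fn.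
case: (ex_minnP exk) => k fk kmin; exists (N + k%:Z) => // n nNk.
have [/fN//|Nn] := ltP n N; apply/eqP; apply: contraT => fn.
have /kmin : f (N + (absz (n - N)%R)%:Z) != 0.
  by have -> : N + (absz (n - N)%R)%:Z = n by lia.
lia.
Qed.

Lemma linv_ex f : f != 0 -> exists g, g * f = 1.
Proof.
move=> /lvaluation[N fN0 fN].
pose u := ps_inv (fun k => f (N + k%:Z)).
pose gf (n : int) := if 0 <= n + N then u (absz (n + N)%R) else 0.
have gfN n : n < - N -> gf n = 0 by move=> nN; rewrite /gf ifF //; lia.
have gP : gf \in @lower_truncated K by apply/asboolP; exists (- N).
exists (Laurent gP); rewrite mulrC; apply: lcoefP => n.
have [n0|n0] := ltP n 0.
  rewrite [LHS](@lscale_coef_low _ K^o N (- N)) //=; last by rewrite subrr.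
  by case: eqP n0 => // ->.
rewrite [LHS](@lscale_coefE _ K^o N (absz n).+1) //; last first.
  by move=> j jn; apply: gfN; lia.
have := @ps_invP K (fun k => f (N + k%:Z)) (absz n).
rewrite addr0 => /(_ fN0) /= /[!absz_eq0] uP.
transitivity ((n == 0)%:R : K); last by case: eqP.
rewrite -uP; apply: eq_bigr => k _; congr (_ * _); rewrite /gf.
have kn := ltn_ord k; rewrite ifT; last by lia.
by congr u; lia.
Qed.

Definition linv f : laurent K := xget 0 [set g | g * f = 1].

Lemma lmulVf f : f != 0 -> linv f * f = 1.
Proof. by move=> /linv_ex[g gf]; apply: (@xgetPex _ 0 [set g | g * f = 1]); exists g. Qed.

Lemma linv0 : linv 0 = 0.
Proof.
apply: xgetPN => g /=; rewrite mulr0 => /esym/eqP.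
by rewrite (negPf (oner_neq0 _)).
Qed.

HB.instance Definition _ := GRing.ComNzRing_isField.Build (laurent K)
  lmulVf linv0.

End LaurentField.

Section LaurentMap.
Variables (M N : zmodType) (h : {additive M -> N}).

Lemma lmap_subproof (f : laurent M) : (fun n => h (f n)) \in @lower_truncated N.
Proof.
have [P fP] := lbound f; apply/asboolP; exists P => n /fP->; exact: raddf0.
Qed.
Definition lmap (f : laurent M) : laurent N := Laurent (lmap_subproof f).

Lemma lmap_is_additive : zmod_morphism lmap.
Proof. by move=> f g; apply: lcoefP => n; exact: (raddfB h). Qed.
HB.instance Definition _ := GRing.isZmodMorphism.Build _ _ lmap lmap_is_additive.

End LaurentMap.

Section LaurentSeries.
Variable M : zmodType.

Lemma lseries_subproof (u : nat -> M) :
  (fun n : int => if n is Posz k then u k else 0) \in @lower_truncated M.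
Proof. by apply/asboolP; exists 0 => -[]. Qed.
Definition lseries (u : nat -> M) : laurent M := Laurent (lseries_subproof u).

End LaurentSeries.

(* [itL n K] is [K((x_1))...((x_n))] and [itM n M] is [M((x_1))...((x_n))]: *)
(* the recursion peels off the innermost variable [x_1], so that            *)
(* [itL n.+1 K] is by definition [itL n (laurent K)].                       *)
Fixpoint itL (n : nat) (K : fieldType) : fieldType :=
  if n is p.+1 then itL p (laurent K) else K.

Fixpoint itM (n : nat) : forall K : fieldType, lmodType K -> lmodType (itL n K) :=
  match n return forall K : fieldType, lmodType K -> lmodType (itL n K) with
  | 0 => fun K M => M
  | p.+1 => fun K M => itM p (laurent M : lmodType (laurent K))
  end.

Fixpoint itC (n : nat) : forall K : fieldType, {rmorphism K -> itL n K} :=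
  match n return forall K : fieldType, {rmorphism K -> itL n K} with
  | 0 => fun K => idfun
  | p.+1 => fun K => itC p (laurent K) \o (@lconst K)
  end.

Fixpoint itmap (n : nat) : forall (K K' : fieldType) (M : lmodType K)
    (M' : lmodType K'), {additive M -> M'} -> itM n M -> itM n M' :=
  match n return forall (K K' : fieldType) (M : lmodType K)
    (M' : lmodType K'), {additive M -> M'} -> itM n M -> itM n M' with
  | 0 => fun K K' M M' h => h
  | p.+1 => fun K K' M M' h =>
      @itmap p (laurent K) (laurent K') (laurent M) (laurent M') (lmap h)
  end.

Section Fps.
Variables (n : nat) (R : comNzRingType).

Record fps := Fps { fcoef :> 'X_{1..n} -> R }.
HB.instance Definition _ := [isNew for fcoef].
HB.instance Definition _ := [Choice of fps by <:].
Implicit Types f g h : fps.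

Lemma fpsP f g : f =1 g -> f = g.
Proof. by move=> fg; apply/val_inj/funext. Qed.

Definition fps_add f g := Fps (fun m => f m + g m).
Definition fps_opp f := Fps (fun m => - f m).
Definition fpsC (c : R) := Fps (fun m => if m == 0%MM then c else 0).
Definition fps_mul f g := Fps (fun m =>
  \sum_(k : 'X_{1..n < (mdeg m).+1, (mdeg m).+1} | m == (k.1 + k.2)%MM)
    f k.1 * g k.2).

Lemma fps_addA : associative fps_add.
Proof. by move=> f g h; apply: fpsP => m /=; rewrite addrA. Qed.
Lemma fps_addC : commutative fps_add.
Proof. by move=> f g; apply: fpsP => m /=; rewrite addrC. Qed.
Lemma fps_add0 : left_id (fpsC 0) fps_add.
Proof. by move=> f; apply: fpsP => m /=; rewrite if_same add0r. Qed.
Lemma fps_addN : left_inverse (fpsC 0) fps_opp fps_add.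
Proof. by move=> f; apply: fpsP => m /=; rewrite if_same addNr. Qed.
HB.instance Definition _ := GRing.isZmodule.Build fps
  fps_addA fps_addC fps_add0 fps_addN.

Definition fps_of_mpoly (p : {mpoly R[n]}) := Fps (fun m => p@_m).
Definition fps_trunc d f : {mpoly R[n]} :=
  \sum_(m : 'X_{1..n < d}) f m *: 'X_[m].

Lemma fps_truncE d f m : (mdeg m < d)%N -> (fps_trunc d f)@_m = f m.
Proof. exact: mcoeff_mpoly. Qed.

Lemma fps_mulE d f g m : (mdeg m < d)%N ->
  fps_mul f g m = (fps_trunc d f * fps_trunc d g)@_m.
Proof.
move=> md; rewrite mcoeffM; apply: eq_bigr => -[k1 k2] /= _.
by rewrite !fps_truncE // ?(leq_trans (valP k1)) ?(leq_trans (valP k2)).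
Qed.

Lemma eq_mcoeffM d (p p' q q' : {mpoly R[n]}) m : (mdeg m < d)%N ->
  (forall k, (mdeg k < d)%N -> p@_k = p'@_k) ->
  (forall k, (mdeg k < d)%N -> q@_k = q'@_k) -> (p * q)@_m = (p' * q')@_m.
Proof.
move=> md pp' qq'; rewrite !mcoeffM; apply: eq_bigr => -[k1 k2] /= _.
by rewrite pp' ?qq' // ?(leq_trans (valP k1)) ?(leq_trans (valP k2)).
Qed.

Lemma fps_mulC : commutative fps_mul.
Proof.
by move=> f g; apply: fpsP => m; rewrite !(@fps_mulE (mdeg m).+1) // mulrC.
Qed.

Lemma fps_mulA : associative fps_mul.
Proof.
move=> f g h; apply: fpsP => m; rewrite !(@fps_mulE (mdeg m).+1) //.
pose T := fps_trunc (mdeg m).+1.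
have TM u v k : (mdeg k < (mdeg m).+1)%N -> (T (fps_mul u v))@_k = (T u * T v)@_k.
  by move=> km; rewrite fps_truncE // (fps_mulE _ _ km).
rewrite (@eq_mcoeffM (mdeg m).+1 _ (T f) _ (T g * T h)) //; last exact: TM.
by rewrite mulrA; apply/esym/(@eq_mcoeffM (mdeg m).+1) => //; apply: TM.
Qed.

Lemma fps_mul1 : left_id (fpsC 1) fps_mul.
Proof.
move=> f; apply: fpsP => m; rewrite (@fps_mulE (mdeg m).+1) //.
rewrite (@eq_mcoeffM (mdeg m).+1 _ 1 _ (fps_trunc (mdeg m).+1 f)) //.
  by rewrite mul1r fps_truncE.
by move=> k km; rewrite fps_truncE // mcoeff1 /=; case: eqP.
Qed.

Lemma fps_mulDl : left_distributive fps_mul +%R.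
Proof.
move=> f g h; apply: fpsP => m /=.
by rewrite -big_split /=; apply: eq_bigr => k _; rewrite -mulrDl.
Qed.

Lemma fps_one_neq0 : fpsC 1 != 0.
Proof.
apply/eqP => /(congr1 (fun f : fps => f 0%MM)) /= /eqP.
by rewrite eqxx (negPf (oner_neq0 R)).
Qed.

HB.instance Definition _ := GRing.Zmodule_isComNzRing.Build fps
  fps_mulA fps_mulC fps_mul1 fps_mulDl fps_one_neq0.

Lemma fcoefD f g m : (f + g) m = f m + g m. Proof. by []. Qed.
Lemma fcoefN f m : (- f) m = - f m. Proof. by []. Qed.
Lemma fcoef0 m : (0 : fps) m = 0. Proof. exact: if_same. Qed.
Lemma fcoefM f g m : (f * g) m =
  \sum_(k : 'X_{1..n < (mdeg m).+1, (mdeg m).+1} | m == (k.1 + k.2)%MM)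
    f k.1 * g k.2.
Proof. by []. Qed.

Lemma fps_of_mpoly_is_additive : zmod_morphism fps_of_mpoly.
Proof. by move=> p q; apply: fpsP => m; rewrite /= mcoeffB. Qed.
HB.instance Definition _ := GRing.isZmodMorphism.Build _ _ fps_of_mpoly
  fps_of_mpoly_is_additive.

Lemma fps_of_mpoly_is_monoid_morphism : monoid_morphism fps_of_mpoly.
Proof.
split=> [|p q]; apply: fpsP => m; last by rewrite /= mcoeffM.
by rewrite /= mcoeff1; case: eqP.
Qed.
HB.instance Definition _ := GRing.isMonoidMorphism.Build _ _ fps_of_mpoly
  fps_of_mpoly_is_monoid_morphism.

Lemma fps_of_mpoly_inj : injective fps_of_mpoly.
Proof.
by move=> p q pq; apply/mpolyP => m; apply: (congr1 (fun f : fps => f m) pq).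
Qed.

Definition fps_unit : {pred fps} := [pred f | `[< exists g, g * f = 1 >]].
Definition fps_inv f : fps := xget f [set g | g * f = 1].

Lemma fps_mulVr : {in fps_unit, left_inverse 1 fps_inv *%R}.
Proof.
by move=> f /asboolP[g gf]; apply: (@xgetPex _ f [set g | g * f = 1]); exists g.
Qed.
Lemma fps_unitP f g : g * f = 1 -> fps_unit f.
Proof. by move=> gf; apply/asboolP; exists g. Qed.
Lemma fps_inv_out : {in [predC fps_unit], fps_inv =1 id}.
Proof.
by move=> f /negP nf; apply: xgetPN => g gf; apply/nf/asboolP; exists g.
Qed.
HB.instance Definition _ := GRing.ComNzRing_hasMulInverse.Build fps
  fps_mulVr fps_unitP fps_inv_out.

Definition fps_deriv (i : 'I_n) f := Fps (fun m => f (m + U_(i))%MM *+ (m i).+1).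

(* The series [u(x_i)], for a series [u] in one variable. *)
Definition fps_in_var (i : 'I_n) (u : nat -> R) :=
  Fps (fun m => if m == (U_(i) *+ m i)%MM then u (m i) else 0).

End Fps.

Section FpsIdomain.
Variables (n : nat) (F : fieldType).
Implicit Types f g : fps n F.

Lemma fps_valuation f : f != 0 ->
  exists2 m, f m != 0 & forall k, (k < m)%O -> f k = 0.
Proof.
move=> f0; apply: contrapT => nex; case/eqP: f0; apply: fpsP => m.
rewrite fcoef0; elim/(@ltmwf n): m => m IHm; apply: contrapT => /eqP fm.
by case: nex; exists m.
Qed.

Lemma fps_integral : GRing.integral_domain_axiom (fps n F).
Proof.
move=> f g fg0; apply: contraT; rewrite negb_or.
move=> /andP[/fps_valuation[a fa fk] /fps_valuation[b gb gk]].
have /eqP := congr1 (fun h : fps n F => h (a + b)%MM) fg0.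
have da : (mdeg a < (mdeg (a + b)).+1)%N by rewrite ltnS mdegD leq_addr.
have db : (mdeg b < (mdeg (a + b)).+1)%N by rewrite ltnS mdegD leq_addl.
rewrite fcoef0 fcoefM (bigD1 (BMultinom da, BMultinom db)) //= big1 ?addr0.
  by rewrite mulf_eq0 (negPf fa) (negPf gb).
case=> k1 k2 /= /andP[/eqP abk nek].
have [/fk->|ak1|ak1] := ltgtP (bmnm k1) a; first by rewrite mul0r.
  have [/gk->|bk2] := ltP (bmnm k2) b; first by rewrite mulr0.
  by have := ltmc_le_add ak1 bk2; rewrite -abk ltxx.
case/eqP: nek; congr (_, _); apply: val_inj => //=.
by apply: (@addmI _ a); rewrite -{1}ak1 -abk.
Qed.
HB.instance Definition _ := GRing.ComUnitRing_isIntegral.Build (fps n F)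
  fps_integral.

End FpsIdomain.

Local Notation "x %:F" := (@FracField.tofrac _ x).

Section Fstar.
Variables (n : nat) (F : fieldType).

Definition fstar_pred : {pred {fraction fps n F}} :=
  [pred q | `[< exists (g : fps n F) (p : {mpoly F[n]}),
                  p != 0 /\ q = g%:F / (fps_of_mpoly p)%:F >]].

Lemma fps_of_mpoly_neq0 (p : {mpoly F[n]}) : p != 0 -> (fps_of_mpoly p)%:F != 0.
Proof.
by rewrite tofrac_eq0; apply: contraNneq => p0; apply/eqP/fps_of_mpoly_inj; rewrite p0 raddf0.
Qed.

Lemma fstar_subring : subring_closed fstar_pred.
Proof.
split=> [|f g|f g].
- by apply/asboolP; exists 1, 1; rewrite oner_neq0 !rmorph1 divr1.
- move=> /asboolP[a [p [p0 ->]]] /asboolP[b [q [q0 ->]]]; apply/asboolP.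
  exists (a * fps_of_mpoly q - b * fps_of_mpoly p), (p * q).
  rewrite mulf_neq0 //; split=> //.
  rewrite (rmorphM (@fps_of_mpoly n F)) tofracB !tofracM.
  by rewrite -mulNr (addf_div _ _ (fps_of_mpoly_neq0 p0) (fps_of_mpoly_neq0 q0)) mulNr.
move=> /asboolP[a [p [p0 ->]]] /asboolP[b [q [q0 ->]]]; apply/asboolP.
exists (a * b), (p * q); rewrite mulf_neq0 //; split=> //.
by rewrite (rmorphM (@fps_of_mpoly n F)) !tofracM mulf_div.
Qed.
HB.instance Definition _ := GRing.isSubringClosed.Build _ fstar_pred fstar_subring.

Record fstar := Fstar { fstar_val :> {fraction fps n F}; _ : fstar_val \in fstar_pred }.
HB.instance Definition _ := [isSub for fstar_val].
HB.instance Definition _ := [Choice of fstar by <:].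
HB.instance Definition _ := [SubChoice_isSubComNzRing of fstar by <:].

Lemma fstar_frac_subproof (g : fps n F) (p : {mpoly F[n]}) : p != 0 ->
  g%:F / (fps_of_mpoly p)%:F \in fstar_pred.
Proof. by move=> p0; apply/asboolP; exists g, p. Qed.
Definition fstar_frac g p (p0 : p != 0) : fstar := Fstar (fstar_frac_subproof g p0).

Lemma fstar_ex (f : fstar) : exists gp : fps n F * {mpoly F[n]},
  gp.2 != 0 /\ fstar_val f = gp.1%:F / (fps_of_mpoly gp.2)%:F.
Proof. by have /asboolP[g [p gp]] := valP f; exists (g, p). Qed.

Definition fstar_num f := (projT1 (cid (fstar_ex f))).1.
Definition fstar_den f := (projT1 (cid (fstar_ex f))).2.

Lemma fstar_den_neq0 f : fstar_den f != 0.
Proof. by rewrite /fstar_den; case: cid => gp []. Qed.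

Lemma fstarE f : fstar_val f = (fstar_num f)%:F / (fps_of_mpoly (fstar_den f))%:F.
Proof. by rewrite /fstar_num /fstar_den; case: cid => gp []. Qed.

End Fstar.

Definition mnm_tail n (m : 'X_{1..n.+1}) : 'X_{1..n} :=
  [multinom m (fintype.lift ord0 i) | i < n].

Section Translation.
Variables (n : nat) (F : fieldType).

Definition fps_sum_deriv (g : fps n F) : fps n F := \sum_(i < n) fps_deriv i g.

(* [e^(t(d/dx_1+...+d/dx_n)) g], as a series in [t,x_1,...,x_n]; the        *)
(* variable [t] is the one of index [ord0].                                 *)
Definition fps_translate (g : fps n F) : fps n.+1 F :=
  Fps (fun m => (m ord0)`!%:R^-1 * iter (m ord0) fps_sum_deriv g (mnm_tail m)).

Lemma fps_sum_derivE g m :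
  fps_sum_deriv g m = \sum_(i < n) g (m + U_(i))%MM *+ (m i).+1.
Proof.
rewrite /fps_sum_deriv; elim/big_rec2: _ => [|i y x _ <-]; last by [].
exact: fcoef0.
Qed.

Lemma iter_fps_sum_deriv_high (d k : nat) (g : fps n F) m :
    (forall m, (d <= mdeg m)%N -> g m = 0) ->
  (d <= k + mdeg m)%N -> iter k fps_sum_deriv g m = 0.
Proof.
move=> gd; elim: k m => [|k IHk] m dm; first exact: gd.
rewrite iterS fps_sum_derivE big1 // => i _.
by rewrite IHk ?mul0rn // mdegD mdeg1 addn1 addnS.
Qed.

Lemma mnm_tail_cons k (m : 'X_{1..n}) : mnm_tail [multinom of k :: m] = m.
Proof. by apply/mnmP => i; rewrite mnmE !(mnm_nth 0%N). Qed.

Lemma mdeg_tail (m : 'X_{1..n.+1}) : mdeg m = (m ord0 + mdeg (mnm_tail m))%N.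
Proof.
rewrite !mdegE big_ord_recl; congr (_ + _)%N.
by apply: eq_bigr => i _; rewrite mnmE.
Qed.

Lemma fps_translate_poly (p : {mpoly F[n]}) : p != 0 ->
  exists2 q : {mpoly F[n.+1]}, q != 0 & fps_translate (fps_of_mpoly p) = fps_of_mpoly q.
Proof.
move=> p0; pose q := fps_trunc (msize p) (fps_translate (fps_of_mpoly p)).
have pq : fps_translate (fps_of_mpoly p) = fps_of_mpoly q.
  apply: fpsP => m; rewrite [RHS]/=; have [mp|pm] := ltnP (mdeg m) (msize p).
    by rewrite fps_truncE.
  rewrite /= (@iter_fps_sum_deriv_high (msize p)) ?mulr0 -?mdeg_tail //.
    rewrite /q /fps_trunc raddf_sum big1 // => k _ /=.
    rewrite mcoeffZ mcoeffX; case: eqP => [km|_]; last by rewrite mulr0.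
    by move: pm; rewrite -km leqNgt (valP k).
  by move=> k pk /=; apply/eqP; rewrite mcoeff_eq0; apply: contraL pk => /msize_mdeg_lt; rewrite ltnNge.
exists q => //; apply: contraNneq p0 => q0; apply/eqP/mpolyP => m.
have := congr1 (fun f : fps n.+1 F => f [multinom of 0%N :: m]) pq.
rewrite q0 /= mnm_tail_cons (mnm_nth 0%N) /= fact0 invr1 mul1r mcoeff0 => ->.
by rewrite mcoeff0.
Qed.

Lemma fstar_translate_subproof (f : fstar n F) :
  (fps_translate (fstar_num f))%:F /
    (fps_translate (fps_of_mpoly (fstar_den f)))%:F \in @fstar_pred n.+1 F.
Proof.
have [q q0 ->] := fps_translate_poly (fstar_den_neq0 f).
exact: fstar_frac_subproof.
Qed.

(* [f(t+x_1,...,t+x_n)] for [f] in [F_*(x_1,...,x_n)]: as                   *)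
(* [e^(t(d/dx_1+...+d/dx_n))] is an algebra morphism, it is computed on the *)
(* numerator and the denominator of any fraction representing [f].          *)
Definition fstar_translate (f : fstar n F) : fstar n.+1 F :=
  Fstar (fstar_translate_subproof f).

End Translation.

(* The inclusion of [K[[x_1,...,x_n]]] in [K((x_1))...((x_n))]. *)
Fixpoint fps_itL (n : nat) : forall K : fieldType, ('X_{1..n} -> K) -> itL n K :=
  match n return forall K : fieldType, ('X_{1..n} -> K) -> itL n K with
  | 0 => fun K g => g 0%MM
  | p.+1 => fun K g =>
      fps_itL (fun m => lseries (fun k => g [multinom of k :: m]))
  end.

(* The algebra morphism extending the inclusion [fps_itL] to                *)
(* [F_*(x_1,...,x_n)]; any fraction representing [f] gives the same value.  *)
Definition iota_ (n : nat) (F : fieldType) (f : fstar n F) : itL n F :=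
  fps_itL (fstar_num f) / fps_itL (fps_of_mpoly (fstar_den f)).

Section FstarVar.
Variables (n : nat) (F : fieldType).

Definition fstarC (c : F) : fstar n F := fstar_frac (fpsC n c) (oner_neq0 _).

Definition lpole (h : laurent F) : nat :=
  xget 0%N [set N : nat | forall k : int, k < - N%:Z -> h k = 0].

Lemma mpolyXi_neq0 (i : 'I_n) N : ('X_i ^+ N : {mpoly F[n]}) != 0.
Proof. by apply/expf_neq0; rewrite -msupp_eq0 msuppX. Qed.

(* [h(x_i)] for [h] in [F((t))], as [(x_i^N h(x_i)) / x_i^N]. *)
Definition fstar_in_var (i : 'I_n) (h : laurent F) : fstar n F :=
  fstar_frac (fps_in_var i (fun k => h (k%:Z - (lpole h)%:Z)))
    (mpolyXi_neq0 i (lpole h)).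

End FstarVar.

Definition restr (R S : nzRingType) (phi : {rmorphism R -> S})
  (M : lmodType S) : Type := M.

Section Restr.
Variables (R S : nzRingType) (phi : {rmorphism R -> S}) (M : lmodType S).
HB.instance Definition _ := GRing.Zmodule.on (restr phi M).

Definition restr_scale (c : R) (v : restr phi M) : restr phi M :=
  phi c *: (v : M).

Lemma restr_scaleA a b v : restr_scale a (restr_scale b v) = restr_scale (a * b) v.
Proof. by rewrite /restr_scale scalerA rmorphM. Qed.
Lemma restr_scale1 : left_id 1 restr_scale.
Proof. by move=> v; rewrite /restr_scale rmorph1 scale1r. Qed.
Lemma restr_scaleDr : right_distributive restr_scale +%R.
Proof. by move=> c u v; rewrite /restr_scale scalerDr. Qed.
Lemma restr_scaleDl v : {morph restr_scale^~ v : a b / a + b}.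
Proof. by move=> a b; rewrite /restr_scale rmorphD scalerDl. Qed.
HB.instance Definition _ := GRing.Zmodule_isLmodule.Build R (restr phi M)
  restr_scaleA restr_scale1 restr_scaleDr restr_scaleDl.
End Restr.

Definition binz (F : fieldType) (z : int) (j : nat) : F :=
  (\prod_(i < j) (z - i%:Z))%:~R / j`!%:R.

Section DoubleSeries.
Variables (F : fieldType) (V : lmodType F).
Implicit Types E : int -> int -> V.

(* A doubly infinite series in two variables is given by its coefficients; *)
(* [E a b] is the coefficient of [x_0^a x_2^b] (resp. [x_1^a x_2^b]).      *)

(* [E(x_0+x_2,x_2)], powers of [x_0+x_2] being expanded in nonnegative     *)
(* powers of [x_2].                                                        *)
Definition subst_x0x2 E : int -> int -> V := fun a b =>
  \sum_(j \in [set: nat]) binz F (a + j%:Z) j *: E (a + j%:Z) (b - j%:Z).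

(* [(x_0+x_2) E(x_0,x_2)] *)
Definition mul_x0x2 E : int -> int -> V := fun a b => E (a - 1) b + E a (b - 1).

End DoubleSeries.

Record nonlocal_vertex_algebra (F : fieldType) (V : lmodType F) :=
  NonlocalVertexAlgebra {
    nva_Y : V -> V -> laurent V;
    nva_vac : V;
    nva_linl : forall v n, linear (fun u => nva_Y u v n);
    nva_linr : forall u n, linear (fun v => nva_Y u v n);
    nva_vacl : forall v, nva_Y nva_vac v = lconst v;
    nva_creation : forall v n, n < 0 -> nva_Y v nva_vac n = 0;
    nva_creation0 : forall v, nva_Y v nva_vac 0 = v;
    nva_weak_assoc : forall u v w, exists l : nat,
      iter l (@mul_x0x2 F V)
        (subst_x0x2 (fun a b => nva_Y u (nva_Y v w b) a)) =
      iter l (@mul_x0x2 F V) (fun a b => nva_Y (nva_Y u v a) w b)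
  }.

(* [v_n w], where [Y(v,x) = \sum_n v_n x^(-n-1)]. *)
Definition nva_mode (F : fieldType) (V : lmodType F)
    (A : nonlocal_vertex_algebra V) (v : V) (n : int) (w : V) : V :=
  nva_Y A v w (- n - 1).

Section FtAlgebra.
Variable F : fieldType.

Definition lderiv_fun (f : laurent F) (n : int) : F := (n + 1)%:~R * f (n + 1).

Lemma lderiv_subproof f : lderiv_fun f \in @lower_truncated F.
Proof.
have [N fN] := lbound f; apply/asboolP; exists (N - 1) => n nN.
by rewrite /lderiv_fun fN ?mulr0 //; lia.
Qed.
Definition lderiv f : laurent F := Laurent (lderiv_subproof f).

(* [f(t+x) = e^(x d/dt) f(t)] as an element of [F((t))((x))]. *)
Definition ltaylor (f : laurent F) : laurent (laurent F) :=
  lseries (fun k => lconst (k`!%:R^-1) * iter k lderiv f).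

Definition overF (V : lmodType (laurent F)) : lmodType F :=
  restr (@lconst F) V.

Record nonlocal_vertex_Ft_algebra (V : lmodType (laurent F)) :=
  NonlocalVertexFtAlgebra {
    nva_base :> nonlocal_vertex_algebra (overF V);
    nva_Ft : forall (f g : laurent F) (u v : V),
      nva_Y nva_base (f *: u) (g *: v) =
      (ltaylor f * lconst g) *: (nva_Y nva_base u v : laurent V)
  }.

End FtAlgebra.

Section AdjointModule.
Variables (F : fieldType) (V : lmodType (laurent F)).
Variable A : nonlocal_vertex_Ft_algebra V.

Record nva_submodule (W : set V) : Prop := NvaSubmodule {
  nva_sub0 : W 0;
  nva_subP : forall (c : F) (u v : overF V), W u -> W v -> W (c *: u + v);
  nva_sub_mode : forall v n w, W w -> W (nva_mode A v n w)
}.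

Definition nva_irreducible : Prop :=
  (exists v : V, v != 0) /\
  (forall W : set V, nva_submodule W -> W = [set 0] \/ W = [set: V]).

Definition nva_End_eq_Ft : Prop :=
  forall phi : {linear overF V -> overF V},
    (forall v n w, phi (nva_mode A v n w) = nva_mode A v n (phi w)) ->
  exists f : laurent F, forall w : V, phi w = f *: w.

End AdjointModule.

Section BoxTensor.
Variables (F : fieldType) (V : lmodType (laurent F)) (n : nat).
Implicit Types (v : {ffun 'I_n -> overF V}) (f g : fstar n F).

(* A generator [(v,f)] stands for [v^(1) (x) ... (x) v^(n) (x) f]. *)
Definition box_gen : Type := {ffun 'I_n -> overF V} * fstar n F.
HB.instance Definition _ := Choice.on box_gen.

Definition box_free : Type := {freeg box_gen / F}.
HB.instance Definition _ := GRing.Lmodule.on box_free.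

Definition box_pure v f : box_free := << ((v, f) : box_gen) >>.

Definition ffset v (i : 'I_n) (u : overF V) : {ffun 'I_n -> overF V} :=
  [ffun j => if j == i then u else v j].

(* [box_linear_vect] and [box_linear_fun] are the relations presenting the  *)
(* tensor product over [F] of [n] copies of [V] and [F_*(x_1,...,x_n)];     *)
(* [box_balance] is the further relation moving [F((t))]-scalars.           *)
Inductive box_rel : box_free -> Prop :=
| box_linear_vect v i (c : F) (a b : overF V) f :
    box_rel (box_pure (ffset v i (c *: a + b)) f -
      (c *: box_pure (ffset v i a) f + box_pure (ffset v i b) f))
| box_linear_fun v (c : F) f g :
    box_rel (box_pure v (fstarC n c * f + g) - (c *: box_pure v f + box_pure v g))
| box_balance v (h : 'I_n -> laurent F) f :
    box_rel (box_pure [ffun i => h i *: (v i : V) : overF V] f -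
      box_pure v (\prod_(i < n) fstar_in_var i (h i) * f))
| box_rel0 : box_rel 0
| box_relP (c : F) a b : box_rel a -> box_rel b -> box_rel (c *: a + b).

Definition box_null : {pred box_free} := [pred a | `[< box_rel a >]].

Lemma box_null_zmod : zmod_closed box_null.
Proof.
split=> [|a b /asboolP ra /asboolP rb]; apply/asboolP; first exact: box_rel0.
by rewrite addrC -scaleN1r; apply: box_relP.
Qed.
HB.instance Definition _ := GRing.isZmodClosed.Build _ box_null box_null_zmod.

(* [V^(x)n [x] F_*(x_1,...,x_n)] *)
Definition box : zmodType := Quotient.quot box_null.

End BoxTensor.

Section NonDegenerate.
Variables (F : fieldType) (V : lmodType (laurent F)).
Variable A : nonlocal_vertex_Ft_algebra V.

Lemma nva_Y_is_additive (v : V) : zmod_morphism (nva_Y A v : V -> laurent V).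
Proof.
move=> a b; apply: lcoefP => n; rewrite addrC -[in LHS]scaleN1r.
have -> : (-1 : laurent F) = lconst (-1) by rewrite raddfN.
rewrite [LHS](nva_linr A v n (-1)) addrC.
by rewrite -[X in _ + X]/(lconst (-1) *: _) raddfN scaleN1r.
Qed.
HB.instance Definition _ v := GRing.isZmodMorphism.Build V (laurent V)
  (nva_Y A v : V -> laurent V) (nva_Y_is_additive v).

(* [Y(v_1,x_1)...Y(v_n,x_n)1]: [Y(v_1,x_1)] is applied to the coefficients  *)
(* of [Y(v_2,x_2)...Y(v_n,x_n)1].                                           *)
Fixpoint Yprod n : ('I_n -> V) -> itM n V :=
  match n return ('I_n -> V) -> itM n V with
  | 0 => fun _ => nva_vac A
  | p.+1 => fun v =>
      @itmap p (laurent F) (laurent (laurent F)) V (laurent V)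
        (nva_Y A (v ord0) : V -> laurent V)
        (Yprod (fun i => v (fintype.lift ord0 i)))
  end.

(* [V((x_1))...((x_n))] as a vector space over [F]. *)
Definition series_space n : lmodType F :=
  restr ((itC n (laurent F)) \o (@lconst F)) (itM n V).

(* The lift of [Z_n] to the free vector space of which [box V n] is a       *)
(* quotient; [iota_] is here [iota_(t,x_1,...,x_n)], whose target           *)
(* [itL n.+1 F] is [itL n (laurent F)].                                     *)
Definition Zmap n : box_free V n -> series_space n :=
  fglift (fun s : box_gen V n =>
    (iota_ (fstar_translate s.2) : itL n (laurent F)) *: Yprod s.1
      : series_space n).

(* Injectivity of [Z_n], the map induced by [Zmap] on the quotient.         *)
Definition nva_nondegenerate : Prop := forall n, (0 < n)%N ->
  forall a b : box_free V n, Zmap a = Zmap b -> a = b %[mod box V n].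

End NonDegenerate.

(* Main.v *)
(* Put K = F((t)). Weak associativity gives more than is asked for: if       *)
(* e_1,...,e_m in V are linearly independent over K, then the series         *)
(* Y(e_j1,x_1)...Y(e_jn,x_n)1 are linearly independent over the whole field  *)
(* K((x_1))...((x_n)), by induction on n.                                    *)
(*   A relation sum_i c_i Y(u_i,x_1)w_i = 0 with c_i in K((x_1)) persists    *)
(* when all u_i are replaced by v_a u_i: apply Y(v,x_0+x_1), use weak        *)
(* associativity and cancel the power of x_0+x_1. It thus persists under     *)
(* the algebra generated by the modes v_a, and by Jacobson density this      *)
(* algebra contains an operator sending e_k to 1 and the other e_j to 0. As  *)
(* Y(1,x_1) = 1, applying it leaves a relation between the products in       *)
(* x_2,...,x_n whose coefficients alone involve x_1, and the coefficients    *)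
(* of the powers of x_1 are relations of length n-1.                         *)
(*   Finally every element of the tensor product is a sum of terms           *)
(* e_j1 (x) ... (x) e_jn (x) f_j with e free over K, and                     *)
(* f |-> iota f(t+x_1,...,t+x_n) is an injective algebra morphism taking     *)
(* h(x_i) to h(t+x_i).                                                       *)

From HB Require Import structures.
From mathcomp Require Import all_boot all_order all_algebra.
From mathcomp Require Import boolp classical_sets functions cardinality fsbigop.
From mathcomp Require Import freeg mpoly.
From mathcomp Require Import zify ring.
Require Import Defs.

Set Implicit Arguments.
Unset Strict Implicit.
Unset Printing Implicit Defensive.

Import Order.TTheory GRing.Theory Num.Theory.

Local Open Scope ring_scope.

(** * Iterated Laurent series *)

(** The difficulty is that the scalars met by Z_n lie in the large field K((x_1))...((x_n)), K =
    F((t)), so independence has to be proved over that field. Weak associativity allows it because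
    it acts on the left argument of Y. Suppose the sum of the c_i(x_2) Y(u_i,x_2)w_i is zero. After
    multiplication by a power of x_0+x_2, the sum of the c_i(x_2) Y(Y(v,x_0)u_i,x_2)w_i is
    Y(v,x_0+x_2) applied to the given relation, since the modes of v are K-linear and commute with
    the c_i. This is [mode_transfer]; [itmap_rel_transfer] carries it under the remaining variables.
    Irreducibility and the hypothesis on endomorphisms give Jacobson density ([density]), hence
    operators isolating one member of a free family ([free_family_selector]). With [itmap_slice]
    they drive the induction on n in [Yprod_independent]. For an element of the kernel,
    [free_span_extend] and [box_repr_pure] provide a normal form over a free family, and
    [Zmap_box_rel] shows that this normal form has the same image. Independence kills the scalars
    [psi (f J)], and [psi_eq0] then kills the [f J]. Characteristic zero is what makes the
    translation by t a multiplicative exponential. *)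

Section LaurentCoef.
Variables (R : comNzRingType) (M : lmodType R).

(** The lower bounds [N] and [P] need not be sharp, so several series can be summed over one common
    index range. *)
Lemma lcoefZE (N P : int) (f : laurent R) (m : laurent M) (n : int) :
    (forall i, i < N -> f i = 0) -> (forall j, j < P -> m j = 0) ->
  (f *: m) n = \sum_(k < (absz (n - N - P)%R).+1) f (N + k%:Z) *: m (n - N - k%:Z).
Proof. by move=> fN mP; apply: lscale_coefE => // j jn; apply: mP; lia. Qed.

Lemma lconstZ (c : R) (m : laurent M) n : (lconst c *: m) n = c *: m n.
Proof. exact: lscale_const. Qed.

End LaurentCoef.

Lemma lcoefME (R : comNzRingType) (N P : int) (f g : laurent R) (n : int) :
    (forall i, i < N -> f i = 0) -> (forall j, j < P -> g j = 0) ->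
  (f * g) n = \sum_(k < (absz (n - N - P)%R).+1) f (N + k%:Z) * g (n - N - k%:Z).
Proof. exact: (@lcoefZE R R^o). Qed.

Lemma lcoef_sum (M : zmodType) I (r : seq I) (P : pred I) (E : I -> laurent M) n :
  (\sum_(i <- r | P i) E i) n = \sum_(i <- r | P i) E i n.
Proof. by elim/big_rec2: _ => // i y x _ <-. Qed.

Lemma lbound_seq (T : Type) (M : zmodType) (s : seq T) (w : T -> laurent M) :
  exists N : int, forall n, n < N -> all (fun x => w x n == 0) s.
Proof.
elim: s => [|x s [N sN]] /=; first by exists 0.
have [P xP] := lbound (w x); exists (Num.min N P) => n.
by rewrite lt_min => /andP[nN nP]; rewrite xP // eqxx sN.
Qed.

(** Bundled as an additive map so that [itmap] and [itLmap] can read off a coefficient of the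
    innermost variable. *)
Definition lcoef_at (M : zmodType) (n : int) (f : laurent M) : M := f n.
HB.instance Definition _ (M : zmodType) (n : int) :=
  GRing.isZmodMorphism.Build (laurent M) M (lcoef_at n) (fun f g => erefl).

Lemma itmap_is_additive n (K K' : fieldType) (M : lmodType K) (M' : lmodType K')
  (h : {additive M -> M'}) : zmod_morphism (@itmap n K K' M M' h).
Proof.
elim: n K K' M M' h => [|n IHn] K K' M M' h; first exact: raddfB.
exact: (IHn _ _ (laurent M) (laurent M') (lmap h)).
Qed.
HB.instance Definition _ n K K' M M' h :=
  GRing.isZmodMorphism.Build (itM n M) (itM n M') (@itmap n K K' M M' h)
    (@itmap_is_additive n K K' M M' h).

Fixpoint itLmap (n : nat) : forall K K' : fieldType, {additive K -> K'} ->
    {additive itL n K -> itL n K'} :=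
  match n return forall K K' : fieldType, {additive K -> K'} ->
    {additive itL n K -> itL n K'} with
  | 0 => fun K K' h => h
  | p.+1 => fun K K' h => @itLmap p (laurent K) (laurent K') (lmap h)
  end.

(** The hypothesis survives [lmap] because each coefficient of a product is a finite sum. Two
    instances matter: [g] the identity gives semilinearity ([itmap_semilin]), and [g] the constant
    embedding with [h] and [s] coefficient extraction gives [itmap_slice]. *)
Lemma itmapZ n (K0 K1 K2 : fieldType) (M0 : lmodType K0) (M1 : lmodType K1)
    (M2 : lmodType K2) (g : {additive M0 -> M1}) (h : {additive M1 -> M2})
    (s : {additive K1 -> K2}) (g' : {additive M0 -> M2}) :
    (forall c w, h (c *: g w) = s c *: g' w) ->
  forall (f : itL n K1) (X : itM n M0),
  itmap h (f *: itmap g X) = itLmap n s f *: itmap g' X.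
Proof.
elim: n K0 K1 K2 M0 M1 M2 g h s g' => [|n IHn] K0 K1 K2 M0 M1 M2 g h s g' hs //=.
apply: (IHn _ _ _ (laurent M0) (laurent M1) (laurent M2)
          (lmap g) (lmap h) (lmap s) (lmap g')) => c w.
apply: lcoefP => k; have [[N cN] [P wP]] := (lbound c, lbound w).
rewrite -[LHS]/(h ((c *: (lmap g w : laurent M1)) k)).
rewrite (lcoefZE (N := N) (P := P)) //; last first.
  by move=> j /wP /= ->; rewrite raddf0.
rewrite (lcoefZE (N := N) (P := P)); last 2 first.
- by move=> j /cN /= ->; rewrite raddf0.
- by move=> j /wP /= ->; rewrite raddf0.
by rewrite raddf_sum; apply: eq_bigr => i _; apply: hs.
Qed.

Lemma itmap_id n (K : fieldType) (M : lmodType K) (h : {additive M -> M}) :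
  h =1 id -> @itmap n K K M M h =1 id.
Proof.
elim: n K M h => [|n IHn] K M h hid //=.
by apply: (IHn _ (laurent M) (lmap h)) => w; apply: lcoefP => k; apply: hid.
Qed.

Lemma eq_itmap n (K K' : fieldType) (M : lmodType K) (M' : lmodType K')
    (h g : {additive M -> M'}) : h =1 g -> @itmap n K K' M M' h =1 @itmap n K K' M M' g.
Proof.
elim: n K K' M M' h g => [|n IHn] K K' M M' h g hg //=.
by apply: (IHn _ _ (laurent M) (laurent M') (lmap h) (lmap g)) => w; apply: lcoefP => k; apply: hg.
Qed.

(** Meant for the coefficient maps of the innermost variable: a scalar all of whose slices vanish is
    zero. *)
Lemma itLmap_joint_inj n (T : Type) (K K' : fieldType) (s : T -> {additive K -> K'}) :
    (forall c, (forall t, s t c = 0) -> c = 0) ->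
  forall f : itL n K, (forall t, itLmap n (s t) f = 0) -> f = 0.
Proof.
elim: n K K' s => [|n IHn] K K' s s_inj //=.
apply: (IHn _ _ (fun t => lmap (s t))) => c c0; apply: lcoefP => k.
by apply: s_inj => t; have := congr1 (fun f : laurent K' => f k) (c0 t).
Qed.

Lemma itLmapM n (K K' : fieldType) (s : {additive K -> K'}) :
  {morph s : a b / a * b} -> {morph itLmap n s : a b / a * b}.
Proof.
elim: n K K' s => [|n IHn] K K' s sM //=.
apply: (IHn _ _ (lmap s)) => f g; apply: lcoefP => k.
have [[N fN] [P gP]] := (lbound f, lbound g).
rewrite -[LHS]/(s ((f * g) k)) (lcoefME (N := N) (P := P)) //.
rewrite (lcoefME (N := N) (P := P)); last 2 first.
- by move=> j /fN /= ->; rewrite raddf0.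
- by move=> j /gP /= ->; rewrite raddf0.
by rewrite raddf_sum; apply: eq_bigr => i _; apply: sM.
Qed.

Lemma itLmap_itC n (K K' : fieldType) (s : {additive K -> K'}) c :
  itLmap n s (itC n K c) = itC n K' (s c).
Proof.
elim: n K K' s c => [|n IHn] K K' s c //=.
rewrite (IHn _ _ (lmap s)); congr (itC n _ _).
by apply: lcoefP => k /=; case: eqP; rewrite ?raddf0.
Qed.

(* An implication between relations [\sum c h(w) = 0] over [M] lifts to      *)
(* relations over [M((x_1))...((x_n))], because each coefficient of such a   *)
(* relation is a finite relation over [M].                                   *)
Definition rel_transfer (T : Type) (K : fieldType) (M : zmodType) (N N' : lmodType K)
    (h : T -> M -> N) (h' : T -> M -> N') : Prop :=
  forall s : seq (T * K * M),
    \sum_(x <- s) x.1.2 *: h x.1.1 x.2 = 0 -> \sum_(x <- s) x.1.2 *: h' x.1.1 x.2 = 0.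

Lemma lmap_rel_transfer (T : Type) (K : fieldType) (M : zmodType) (N N' : lmodType K)
    (h : T -> {additive M -> N}) (h' : T -> {additive M -> N'}) :
    rel_transfer h h' ->
  @rel_transfer T (laurent K) (laurent M) (laurent N) (laurent N')
    (fun t => lmap (h t)) (fun t => lmap (h' t)).
Proof.
move=> hh' s s0; apply: lcoefP => k.
have [A sA] := lbound_seq s (fun x => x.1.2); have [B sB] := lbound_seq s (fun x => x.2).
pose K0 := (absz (k - A - B)%R).+1.
(* Every term of every Cauchy product becomes one entry of [s']. The same [s'] serves [h] and [h'],
   because [coefE] holds for any family of additive maps. *)
pose y (x : T * laurent K * laurent M) (i : nat) : T * K * M :=
  (x.1.1, x.1.2 (A + i%:Z), x.2 (k - A - i%:Z)).
pose s' := [seq y x i | x <- s, i <- index_iota 0 K0].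
have coefE (N0 : lmodType K) (g : T -> {additive M -> N0}) :
    (\sum_(x <- s) x.1.2 *: (lmap (g x.1.1) x.2 : laurent N0)) k =
    \sum_(y <- s') y.1.2 *: g y.1.1 y.2.
  rewrite lcoef_sum big_allpairs_dep.
  elim: s sA sB {s' s0} => [|x s IHs] sA sB; first by rewrite !big_nil.
  rewrite big_cons [RHS]big_cons IHs; last 2 first.
  - by move=> n /sA /andP[].
  - by move=> n /sB /andP[].
  congr (_ + _); rewrite big_mkord; apply: lcoefZE.
    by move=> n /sA /andP[/eqP].
  by move=> n /sB /andP[/eqP /= -> _]; rewrite raddf0.
rewrite coefE lcoef0; apply: hh'; rewrite -coefE.
by have := congr1 (fun f : laurent N => f k) s0.
Qed.

Lemma itmap_rel_transfer n (T : Type) (K0 K : fieldType) (M : lmodType K0)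
    (N N' : lmodType K) (h : T -> {additive M -> N}) (h' : T -> {additive M -> N'}) :
    rel_transfer h h' ->
  @rel_transfer T (itL n K) (itM n M) (itM n N) (itM n N')
    (fun t => itmap (h t)) (fun t => itmap (h' t)).
Proof.
elim: n K0 K M N N' h h' => [|n IHn] K0 K M N N' h h' hh' //=.
by apply: (IHn (laurent K0) (laurent K) (laurent M) (laurent N) (laurent N')
  (fun t => lmap (h t)) (fun t => lmap (h' t))); apply: lmap_rel_transfer.
Qed.

(** * Weak associativity *)

Section VertexAlgebra.
Variables (F : fieldType) (V : lmodType (laurent F)).
Variable A : nonlocal_vertex_Ft_algebra V.

Definition vertex_op (u : V) : V -> laurent V := nva_Y A u.
HB.instance Definition _ u := GRing.isZmodMorphism.Build V (laurent V)
  (vertex_op u) (@nva_Y_is_additive F V A u).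

Local Notation Y := vertex_op.

Lemma lderivC (c : F) : lderiv (lconst c) = 0.
Proof.
apply: lcoefP => n; rewrite lcoef0 /= /lderiv_fun /=.
by case: eqP => [->|_]; rewrite ?mul0r ?mulr0.
Qed.

Lemma lderiv0 : lderiv (0 : laurent F) = 0.
Proof. by apply: lcoefP => n; rewrite /= /lderiv_fun lcoef0 mulr0. Qed.

Lemma ltaylorC (c : F) : ltaylor (lconst c) = lconst (lconst c).
Proof.
apply: lcoefP => -[[|k]|k] //=.
  by rewrite fact0 invr1 rmorph1 mul1r.
have -> : lderiv (iter k (@lderiv F) (lconst c)) = 0.
  by rewrite -iterS iterSr lderivC; elim: k => //= k ->; rewrite lderiv0.
by rewrite mulr0.
Qed.

Lemma vertex_op_scaler (g : laurent F) (u w : V) : Y u (g *: w) = lconst g *: Y u w.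
Proof.
have := nva_Ft A 1 g u w; rewrite scale1r.
have -> : ltaylor (1 : laurent F) = 1.
  by rewrite -(rmorph1 (@lconst F)) ltaylorC !rmorph1.
by rewrite mul1r.
Qed.

Lemma vertex_op_scalel (f : laurent F) (u w : V) : Y (f *: u) w = ltaylor f *: Y u w.
Proof. by have := nva_Ft A f 1 u w; rewrite scale1r rmorph1 mulr1. Qed.

Lemma vertex_op_linl (c : F) (u1 u2 w : V) :
  Y (lconst c *: u1 + u2) w = lconst (lconst c) *: Y u1 w + Y u2 w.
Proof.
apply: lcoefP => n; rewrite lcoefD lconstZ.
exact: (nva_linl A w n c).
Qed.

Lemma vertex_opDl (u1 u2 w : V) : Y (u1 + u2) w = Y u1 w + Y u2 w.
Proof.
have := vertex_op_linl 1 u1 u2 w.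
by rewrite !rmorph1 !scale1r.
Qed.

Lemma vertex_op0l (w : V) : Y 0 w = 0.
Proof. by apply: (addrI (Y 0 w)); rewrite -vertex_opDl !addr0. Qed.

Lemma vertex_op_vac (w : V) : Y (nva_vac A) w = lconst w.
Proof. exact: (nva_vacl A w). Qed.

End VertexAlgebra.

Section WeakAssociativity.
Variables (F : fieldType) (V : lmodType F).
Implicit Types E T : int -> int -> V.

(** The coefficient at [(a, b + 1)] expresses [T a b] through [T (a - 1) (b + 1)], so vanishing
    propagates upwards in the exponent of x_0. Truncation gives the start; among all doubly infinite
    series x_0+x_2 is a zero divisor. *)
Lemma mul_x0x2_inj (N : int) T :
    (forall a b, a < N -> T a b = 0) -> (forall a b, mul_x0x2 T a b = 0) ->
  forall a b, T a b = 0.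
Proof.
move=> TN T0; suff H k a b : a < N + k%:Z -> T a b = 0.
  by move=> a b; apply: (H (absz (a - N)%R).+1); lia.
elim: k a b => [|k IHk] a b ak; first by apply: TN; lia.
have := T0 a (b + 1); rewrite /mul_x0x2 IHk ?add0r ?addrK //; lia.
Qed.

Lemma iter_mul_x0x2_inj (N : int) l T :
    (forall a b, a < N -> T a b = 0) ->
    (forall a b, iter l (@mul_x0x2 F V) T a b = 0) ->
  forall a b, T a b = 0.
Proof.
move=> TN; elim: l => //= l IHl T0; apply: IHl.
apply: (mul_x0x2_inj (N := N)) => // {T0}.
elim: l => //= l IHl a b aN; rewrite /mul_x0x2 !IHl ?addr0 //; lia.
Qed.

Lemma iter_mul_x0x2_leq l l' E E' : (l <= l')%N ->
  iter l (@mul_x0x2 F V) E = iter l (@mul_x0x2 F V) E' ->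
  iter l' (@mul_x0x2 F V) E = iter l' (@mul_x0x2 F V) E'.
Proof. by move=> /subnK <- EE'; rewrite !iterD EE'. Qed.

End WeakAssociativity.

(** * Transfer of relations along modes *)

Section ModeTransfer.
Variables (F : fieldType) (V : lmodType (laurent F)).
Variable A : nonlocal_vertex_Ft_algebra V.

Local Notation Y := (vertex_op A).

(** Indexed by the exponent of x, unlike [nva_mode]: the mode v_n is [vertex_mode v (- n - 1)]. *)
Definition vertex_mode (v : V) (a : int) (w : V) : V := Y v w a.

Lemma vertex_mode_is_linear v a : linear (vertex_mode v a).
Proof.
move=> f w w'; rewrite /vertex_mode.
have -> : Y v (f *: w + w') = lconst f *: Y v w + Y v w'.
  by rewrite -vertex_op_scaler; apply: raddfD.
by rewrite lcoefD lconstZ.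
Qed.
HB.instance Definition _ v a := GRing.isLinear.Build (laurent F) V V *:%R
  (vertex_mode v a) (vertex_mode_is_linear v a).

Lemma lmapZ (K : fieldType) (M N : lmodType K) (h : {additive M -> N}) :
  scalable h -> forall (f : laurent K) (m : laurent M),
  lmap h (f *: m) = f *: (lmap h m : laurent N).
Proof.
move=> hZ f m; apply: lcoefP => n; have [[P fP] [Q mQ]] := (lbound f, lbound m).
rewrite -[LHS]/(h ((f *: m) n)) (lcoefZE (N := P) (P := Q)) //.
rewrite (lcoefZE (N := P) (P := Q)) //; last by move=> j /mQ /= ->; rewrite raddf0.
by rewrite raddf_sum; apply: eq_bigr => i _; apply: hZ.
Qed.

(** The variable x_2 itself, as a scalar. *)
Definition lshift : laurent (laurent F) := lseries (fun k => (k == 1)%:R).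

Lemma lshiftZ (m : laurent V) n : (lshift *: m) n = m (n - 1).
Proof.
rewrite /= /lscale_coef (@fsum_seq _ _ [:: 1%:Z]) // ?big_seq1 ?scale1r //.
by move=> [[|[|k]]|k] //=; rewrite ?scale0r // inE.
Qed.

Lemma lshiftXZ j (m : laurent V) n : (lshift ^+ j *: m) n = m (n - j%:Z).
Proof.
elim: j n => [|j IHj] n; first by rewrite expr0 scale1r subr0.
by rewrite exprS -scalerA lshiftZ IHj; congr (m _); lia.
Qed.

(** As [c] starts at exponent [N], the coefficient at [b] reads [m] only up to [b - N]. *)
Lemma eq_lcoefZ (N b : int) (c : laurent (laurent F)) (m m' : laurent V) :
    (forall n, n < N -> c n = 0) -> (forall n, n <= b - N -> m n = m' n) ->
  (c *: m) b = (c *: m') b.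
Proof.
move=> cN mm'; have [P mP] := lbound m; have [P' mP'] := lbound m'.
pose Q := Num.min P P'.
have mQ j : j < Q -> m j = 0 by rewrite lt_min => /andP[/mP].
have mQ' j : j < Q -> m' j = 0 by rewrite lt_min => /andP[_ /mP'].
rewrite (lcoefZE _ cN mQ) (lcoefZE _ cN mQ'); apply: eq_bigr => k _.
by rewrite mm' //; lia.
Qed.

(** A double series is regarded here as a family of Laurent series in x_2 indexed by the exponent of
    x_0. In this form multiplication by x_0+x_2 visibly commutes with scalars in x_2. *)
Definition mul_x0x2_row (R : int -> laurent V) (a : int) : laurent V :=
  R (a - 1) + lshift *: R a.

Lemma iter_mul_x0x2_row l (R : int -> laurent V) a b :
  iter l mul_x0x2_row R a b =
  iter l (@mul_x0x2 F (overF V)) (fun a b => R a b) a b.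
Proof. by elim: l a b => // l IHl a b; rewrite !iterS lcoefD lshiftZ /mul_x0x2 -!IHl. Qed.

Lemma iter_mul_x0x2_row_sum l I (s : seq I) (c : I -> laurent (laurent F))
    (R : I -> int -> laurent V) a :
  iter l mul_x0x2_row (fun a => \sum_(x <- s) c x *: R x a) a =
  \sum_(x <- s) c x *: iter l mul_x0x2_row (R x) a.
Proof.
elim: l a => //= l IHl a; rewrite /mul_x0x2_row !IHl scaler_sumr -big_split /=.
by apply: eq_bigr => x _; rewrite scalerDr !scalerA [lshift * _]mulrC.
Qed.

Lemma eq_iter_mul_x0x2 (B : int) l (E E' : int -> int -> overF V) :
    (forall a b, b < B -> E a b = E' a b) -> forall a b, b < B ->
  iter l (@mul_x0x2 F (overF V)) E a b = iter l (@mul_x0x2 F (overF V)) E' a b.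
Proof.
move=> EE'; elim: l => //= l IHl a b bB; rewrite /mul_x0x2 !IHl //; lia.
Qed.

(* Weak associativity is not uniform in [w], but a relation only involves    *)
(* finitely many vectors, hence one common power of [x_0+x_2].               *)
Lemma mode_transfer (v : V) (a : int) :
  @rel_transfer V (laurent (laurent F)) V (laurent V) (laurent V)
    Y (fun u => Y (vertex_mode v a u)).
Proof.
move=> s s0; apply: lcoefP => b; rewrite lcoef0.
have [N sN] := lbound_seq s (fun x => x.1.2).
have [P sP] := lbound_seq s (fun x => Y x.1.1 x.2).
have [Q sQ] := lbound_seq s (fun x => Y v x.1.1).
pose E (x : V * laurent (laurent F) * V) (a b : int) : overF V :=
  Y v (Y x.1.1 x.2 b) a.
pose H (x : V * laurent (laurent F) * V) (a : int) : laurent V :=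
  Y (vertex_mode v a x.1.1) x.2.
have [l sl] : exists l, forall x, x \in s ->
    iter l (@mul_x0x2 F (overF V)) (subst_x0x2 (E x)) =
    iter l (@mul_x0x2 F (overF V)) (fun a b => H x a b).
  elim: (s) => [|x s' [l IHl]]; first by exists 0%N.
  have [l' xl'] := nva_weak_assoc A v x.1.1 x.2.
  exists (l + l')%N => y; rewrite inE => /predU1P[->|/IHl].
    by apply: iter_mul_x0x2_leq xl'; apply: leq_addl.
  by apply: iter_mul_x0x2_leq; apply: leq_addr.
(* In both variables the wanted relation starts at x_0^Q, because each Y(v,x_0)u is lower truncated.
   Hence the power of x_0+x_2 can be cancelled. *)
pose T (a : int) : laurent V := \sum_(x <- s) x.1.2 *: H x a.
rewrite -[LHS]/(T a b) (iter_mul_x0x2_inj (N := Q) (l := l) (T := fun a b => T a b)) //.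
  move=> {b}a b aQ; rewrite /T big_seq big1 ?lcoef0 // => x xs.
  by rewrite /H /vertex_mode (eqP (allP (sQ _ aQ) _ xs)) vertex_op0l scaler0.
move=> {}a {}b; rewrite -iter_mul_x0x2_row iter_mul_x0x2_row_sum.
(* The terms [j >= J] of the expansion vanish at exponents of x_2 below [P + J], and this [J] puts
   every exponent up to [b - N] there. The coefficient at [b] sees no others, so the finite sums [G]
   may replace the substitution. *)
pose J := (absz (b - N - P)%R).+1.
pose G (x : V * laurent (laurent F) * V) (a : int) : laurent V :=
  \sum_(j < J) lconst (lconst (binz F (a + j%:Z) j)) *:
    (lshift ^+ j *: lmap (vertex_mode v (a + j%:Z)) (Y x.1.1 x.2)).
have GE x a' b' : x \in s -> b' < P + J%:Z -> G x a' b' = subst_x0x2 (E x) a' b'.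
  move=> xs b'P; rewrite /subst_x0x2 (@fsum_seq _ _ (index_iota 0 J)) ?iota_uniq //.
    rewrite big_mkord lcoef_sum; apply: eq_bigr => j _.
    by rewrite lconstZ lshiftXZ.
  move=> j; rewrite mem_index_iota /= -leqNgt => Jj.
  have bP : b' - j%:Z < P by lia.
  by rewrite /E (eqP (allP (sP _ bP) _ xs)) raddf0 scaler0.
transitivity ((\sum_(x <- s) x.1.2 *: iter l mul_x0x2_row (G x) a) b).
  rewrite !lcoef_sum big_seq [RHS]big_seq; apply: eq_bigr => x xs.
  apply: (eq_lcoefZ (N := N)) => [n nN|n nb]; first exact/eqP/(allP (sN _ nN)).
  rewrite !iter_mul_x0x2_row -sl //; apply/esym/(eq_iter_mul_x0x2 (B := P + J%:Z)).
    by move=> a' b' b'B; apply: GE.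
  by rewrite /J; lia.
rewrite -iter_mul_x0x2_row_sum.
(* Modes are K-linear, so they commute with the scalars in x_2: each row is a sum of images of the
   original relation, which is zero. *)
have -> : (fun a => \sum_(x <- s) x.1.2 *: G x a) = (fun=> 0).
  apply: funext => a'; rewrite /G.
  under eq_bigr do rewrite scaler_sumr.
  rewrite exchange_big big1 //= => j _.
  set d := lconst (lconst _).
  transitivity ((d * lshift ^+ j) *:
      (lmap (vertex_mode v (a' + j%:Z)) (\sum_(x <- s) x.1.2 *: Y x.1.1 x.2) : laurent V)).
    rewrite raddf_sum scaler_sumr.
    apply: eq_bigr => x _; transitivity ((d * lshift ^+ j) *: (x.1.2 *:
        (lmap (vertex_mode v (a' + j%:Z)) (Y x.1.1 x.2) : laurent V))).
      by rewrite !scalerA mulrC.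
    by congr (_ *: _); apply/esym/lmapZ => c w; apply: linearZZ.
  by rewrite s0 raddf0 scaler0.
suff -> : iter l mul_x0x2_row (fun=> 0) = fun=> 0 by [].
by elim: (l) => // k IHk; apply: funext => i; rewrite iterS IHk /mul_x0x2_row add0r scaler0.
Qed.

End ModeTransfer.

(** * Density and independence *)

Section Density.
Variables (F : fieldType) (V : lmodType (laurent F)).
Variable A : nonlocal_vertex_Ft_algebra V.

Local Notation Y := (vertex_op A).
Local Notation vac := (nva_vac A : V).

(** This stands in for the algebra generated by the modes: it contains them and is closed under
    composition and F-combinations, so no words in the modes have to be formed. *)
Definition transfer_op (d : V -> V) : Prop :=
  linear d /\
  @rel_transfer V (laurent (laurent F)) V (laurent V) (laurent V) Y (fun u => Y (d u)).

Lemma transfer_op_id : transfer_op id.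
Proof. by split. Qed.

Lemma transfer_op0 : transfer_op (fun=> 0).
Proof.
split=> [f u v|s _]; first by rewrite scaler0 addr0.
by rewrite big1 // => x _; rewrite vertex_op0l scaler0.
Qed.

Lemma transfer_op_mode v n d : transfer_op d -> transfer_op (fun u => vertex_mode A v n (d u)).
Proof.
move=> [dlin dtr]; split=> [f u w|s s0]; first by rewrite dlin linearP.
have := @mode_transfer _ _ A v n [seq (d x.1.1, x.1.2, x.2) | x <- s].
by rewrite !big_map; apply; apply: dtr.
Qed.

Lemma transfer_op_comp d d' : transfer_op d -> transfer_op d' -> transfer_op (d \o d').
Proof.
move=> [dlin dtr] [dlin' dtr']; split=> [f u w|s s0] /=; first by rewrite dlin' dlin.
have := dtr [seq (d' x.1.1, x.1.2, x.2) | x <- s].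
by rewrite !big_map; apply; apply: dtr'.
Qed.

Lemma transfer_op_lin (c : F) d d' : transfer_op d -> transfer_op d' ->
  transfer_op (fun u => lconst c *: d u + d' u).
Proof.
move=> [dlin dtr] [dlin' dtr']; split=> [f u w|s s0].
  rewrite dlin dlin' !scalerDr !scalerA [f * _]mulrC -!addrA; congr (_ + _).
  by rewrite addrCA.
under eq_bigr do rewrite vertex_op_linl scalerDr scalerA [_ * lconst _]mulrC -scalerA.
by rewrite big_split /= dtr' // -scaler_sumr dtr // scaler0 addr0.
Qed.

Lemma linear_op0 (d : V -> V) : linear d -> d 0 = 0.
Proof.
by move=> dlin; have := dlin (-1) 0 0; rewrite scaler0 addr0 scaleN1r addNr.
Qed.

Hypothesis Virr : nva_irreducible A.

(** [P] plays the role of a left ideal. Its values at [w] form a submodule, hence all of V as soon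
    as one of them is nonzero. *)
Lemma transfer_submodule (P : (V -> V) -> Prop) (w : V) :
    P (fun=> 0) ->
    (forall d v n, transfer_op d -> P d -> P (fun u => vertex_mode A v n (d u))) ->
    (forall c d d', P d -> P d' -> P (fun u => lconst c *: d u + d' u)) ->
    (exists d, [/\ transfer_op d, P d & d w != 0]) ->
  forall t, exists d, [/\ transfer_op d, P d & d w = t].
Proof.
move=> P0 Pmode Plin [d1 [d1tr Pd1 d1w]].
pose W : set V := [set t | exists d, [/\ transfer_op d, P d & d w = t]]%classic.
have Wsub : nva_submodule A W.
  split=> [|c u v [d [dtr Pd <-]] [d' [dtr' Pd' <-]]|v n u [d [dtr Pd <-]]].
  - by exists (fun=> 0); split=> //; apply: transfer_op0.
  - exists (fun u => lconst c *: d u + d' u); split=> //.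
      exact: transfer_op_lin.
    exact: Plin.
  exists (fun u => vertex_mode A v (- n - 1) (d u)); split=> //.
    exact: transfer_op_mode.
  exact: Pmode.
have [_ Wdich] := Virr; have [W0|WT] := Wdich W Wsub.
  have : W (d1 w) by exists d1.
  by rewrite W0 /= => d10; rewrite d10 eqxx in d1w.
by move=> t; have : W t by rewrite WT.
Qed.

Lemma transfer_op_transitive (w t : V) : w != 0 -> exists2 d, transfer_op d & d w = t.
Proof.
move=> w0; suff [d [dtr _ dw]] : exists d, [/\ transfer_op d, True & d w = t] by exists d.
apply: (transfer_submodule (P := fun=> True)) => //.
by exists id; split=> //; apply: transfer_op_id.
Qed.

Lemma vac_neq0 : vac != 0.
Proof.
apply/eqP => vac0; have [[v /eqP v0] _] := Virr; apply: v0.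
transitivity (Y v vac 0); first exact/esym/(nva_creation0 A v).
by rewrite vac0 raddf0.
Qed.

Hypothesis VEnd : nva_End_eq_Ft A.

(* If [d (e j0) |-> d v] is well defined on the annihilator of the other     *)
(* [e j], it is a module endomorphism, hence multiplication by a scalar [f], *)
(* and [v - f *: e j0] is killed by that annihilator.                        *)
Lemma density m (e : 'I_m -> V) (js : seq 'I_m) (v : V) :
    (forall d, transfer_op d -> (forall j, j \in js -> d (e j) = 0) -> d v = 0) ->
  exists c : 'I_m -> laurent F,
    (forall j, j \notin js -> c j = 0) /\ v = \sum_j c j *: e j.
Proof.
elim: js v => [|j0 js IHjs] v vjs.
  exists (fun=> 0); split=> //; rewrite (vjs _ transfer_op_id) // big1 // => j _.
  exact: scale0r.
pose kills (d : V -> V) := forall j, j \in js -> d (e j) = 0.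
have [[d1 [d1tr d1k d1e]]|nod] := pselect
    (exists d, [/\ transfer_op d, kills d & d (e j0) != 0]); last first.
  have [|c [cjs ->]] := IHjs v.
    move=> d dtr dk; apply: vjs => // j; rewrite inE => /predU1P[->|/dk//].
    by apply: contrapT => /eqP de; apply: nod; exists d.
  by exists c; split=> // j; rewrite inE negb_or => /andP[_ /cjs].
have dex t : exists d, [/\ transfer_op d, kills d & d (e j0) = t].
  apply: transfer_submodule => // [d u n [dlin _] dk j /dk ->|c d d' dk dk' j jjs|].
  - exact: raddf0.
  - by rewrite dk ?dk' // scaler0 addr0.
  by exists d1.
(* The difference of [d] and [d'] kills [e j0] as well, so by the hypothesis on [v] the value [d v]
   depends on [d (e j0)] alone. *)
have kills_uniq d d' : transfer_op d -> kills d -> transfer_op d' -> kills d' ->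
    d (e j0) = d' (e j0) -> d v = d' v.
  move=> dtr dk dtr' dk' dd'; apply/eqP; rewrite -subr_eq0 -scaleN1r.
  have -> : (-1 : laurent F) = lconst (-1) by rewrite rmorphN1.
  rewrite addrC; apply/eqP; apply: (vjs (fun u => lconst (-1) *: d' u + d u)).
    exact: transfer_op_lin.
  move=> j; rewrite inE rmorphN1 scaleN1r => /predU1P[->|jjs].
    by rewrite dd' addNr.
  by rewrite dk // dk' // oppr0 addr0.
pose dd t := projT1 (cid (dex t)).
have ddP t : [/\ transfer_op (dd t), kills (dd t) & dd t (e j0) = t].
  by rewrite /dd; case: cid.
pose phi (t : overF V) : overF V := dd t v.
have phiE t d : transfer_op d -> kills d -> d (e j0) = t -> phi t = d v.
  by move=> dtr dk de; have [? ? ddt] := ddP t; apply: (kills_uniq (dd t) d); rewrite ?ddt.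
have phi_lin : linear phi.
  move=> c t t'; have [dtr dk de] := ddP t; have [dtr' dk' de'] := ddP t'.
  rewrite [RHS]/(lconst c *: dd t v + dd t' v).
  apply: (phiE _ (fun u => lconst c *: dd t u + dd t' u)).
  - exact: transfer_op_lin.
  - by move=> j jjs; rewrite dk // dk' // scaler0 addr0.
  by rewrite de de'.
pose phiL : {linear overF V -> overF V} :=
  HB.pack phi (GRing.isLinear.Build F (overF V) (overF V) *:%R phi phi_lin).
have [u n t|f phif] := @VEnd phiL.
  have [dtr dk de] := ddP t.
  apply: (phiE _ (fun w => vertex_mode A u (- n - 1) (dd t w))).
  - exact: transfer_op_mode.
  - by move=> j jjs; rewrite dk // raddf0.
  by rewrite de.
have [|c [cjs vc]] := IHjs (v - f *: e j0).
  move=> d [dlin dtr] dk.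
  have -> : v - f *: e j0 = - f *: e j0 + v by rewrite scaleNr addrC.
  rewrite dlin -(phiE (d (e j0)) d) // [phi _]phif scaleNr; exact: addNr.
exists (fun j => c j + (if j == j0 then f else 0)); split.
  move=> j; rewrite inE negb_or => /andP[/negPf-> /cjs->]; exact: addr0.
under eq_bigr do rewrite scalerDl.
rewrite big_split /= -vc (bigD1 j0) //= eqxx big1 ?addr0 ?subrK //.
by move=> j /negPf->; rewrite scale0r.
Qed.

End Density.

Lemma itmap_eq0 n (K K' : fieldType) (M : lmodType K) (M' : lmodType K')
    (h : {additive M -> M'}) : (forall w, h w = 0) -> forall X, @itmap n K K' M M' h X = 0.
Proof.
elim: n K K' M M' h => [|n IHn] K K' M M' h h0 //=.
by apply: (IHn _ _ (laurent M) (laurent M') (lmap h)) => w; apply: lcoefP => k; apply: h0.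
Qed.

Lemma lcoefZ_const (K : fieldType) (M : lmodType K) (c : laurent K) (w : M) a :
  (c *: lconst w) a = c a *: w.
Proof.
rewrite /= /lscale_coef (@fsum_seq _ _ [:: a]) // ?big_seq1 ?subrr //.
by move=> i; rewrite inE /= subr_eq0 eq_sym => /negPf->; rewrite scaler0.
Qed.

(* Once the operators [h] are replaced by [h' = lconst] or [h' = 0], the     *)
(* innermost variable only occurs in the scalars.                           *)
Lemma itmap_slice n (K : fieldType) (V : lmodType K) (T : Type)
    (h h' : T -> {additive V -> laurent V}) (I : finType) (P Q : pred I)
    (t : I -> T) (X : I -> itM n V) (f : I -> itL n (laurent K)) :
    @rel_transfer T (laurent K) V (laurent V) (laurent V) h h' ->
    (forall i w, Q i -> h' (t i) w = lconst w) ->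
    (forall i w, ~~ Q i -> h' (t i) w = 0) ->
    \sum_(i | P i) f i *: itmap (h (t i)) (X i) = 0 ->
  forall a, \sum_(i | P i && Q i) itLmap n (lcoef_at a) (f i) *: X i = 0.
Proof.
move=> hh' hQ hnQ sum0 a.
have {}sum0 : \sum_(i | P i) f i *: itmap (h' (t i)) (X i) = 0.
  pose s := [seq (t i, f i, X i) | i <- index_enum I & P i].
  have := @itmap_rel_transfer n T _ _ V _ _ h h' hh' s.
  by rewrite !big_map !big_filter; apply.
have {}sum0 : \sum_(i | P i && Q i)
    f i *: itmap (@lconst V : {additive V -> laurent V}) (X i) = 0.
  apply: etrans sum0; rewrite [RHS](bigID Q) /= [X in _ = _ + X]big1 ?addr0 => [|i].
    apply: eq_bigr => i /andP[_ Qi]; congr (_ *: _); apply: eq_itmap => w.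
    by rewrite hQ.
  by move=> /andP[_ Qi]; rewrite itmap_eq0 ?scaler0 // => w; rewrite hnQ.
have := congr1 (@itmap n _ _ (laurent V) V (lcoef_at a)) sum0.
rewrite raddf0 raddf_sum => sum1; apply: etrans sum1; apply: eq_bigr => i _.
rewrite -[X i in LHS](@itmap_id n K V idfun) //; apply/esym/itmapZ => c w.
exact: lcoefZ_const.
Qed.

(** * Independence of iterated products *)

Definition free_family (K : fieldType) (V : lmodType K) m (e : 'I_m -> V) : Prop :=
  forall c : 'I_m -> K, \sum_j c j *: e j = 0 -> forall j, c j = 0.

Section Independence.
Variables (F : fieldType) (V : lmodType (laurent F)).
Variable A : nonlocal_vertex_Ft_algebra V.
Hypothesis Virr : nva_irreducible A.
Hypothesis VEnd : nva_End_eq_Ft A.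
Variables (m : nat) (e : 'I_m -> V).
Hypothesis efree : free_family e.

Local Notation Y := (vertex_op A).
Local Notation vac := (nva_vac A : V).

(** If every transfer operator killing the other [e j] killed [e k] too, [density] would put [e k]
    in their span, against freeness. Otherwise irreducibility moves the nonzero value at [e k] to
    the vacuum. *)
Lemma free_family_selector (k : 'I_m) :
  exists2 d, transfer_op A d & forall j, d (e j) = if j == k then vac else 0.
Proof.
have [[d [dtr dk dek]]|nod] := pselect (exists d,
    [/\ transfer_op A d, forall j, j != k -> d (e j) = 0 & d (e k) != 0]).
  have [d' dtr' dvac] := transfer_op_transitive Virr vac dek.
  exists (d' \o d); first exact: transfer_op_comp.
  move=> j /=; case: eqVneq => [->//|jk]; rewrite dk //.
  by apply: linear_op0; have [] := dtr'.
have [|c [ck ek]] := density Virr VEnd (e := e) (js := [seq j <- enum 'I_m | j != k]) (v := e k).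
  move=> d dtr dk; apply: contrapT => /eqP dek; apply: nod; exists d; split=> //.
  by move=> j jk; apply: dk; rewrite mem_filter jk mem_enum.
have := @efree (fun j => c j - (j == k)%:R) _ k.
rewrite ck ?eqxx ?mem_filter ?eqxx // sub0r => /(_ _)/eqP; rewrite oppr_eq0 oner_eq0.
case/(_ _)/notF; under eq_bigr do rewrite scalerBl.
rewrite sumrB -ek (bigD1 k) //= eqxx scale1r big1 ?addr0 ?subrr // => j /negPf->.
exact: scale0r.
Qed.

(** The predicate [P] is there for the induction: a selector keeps only the tuples sharing their
    first index with [J i], and these still have distinct tails. *)
Theorem Yprod_independent n (I : finType) (P : pred I) (J : I -> 'I_n -> 'I_m)
    (f : I -> itL n (laurent F)) :
    (forall i i', P i -> P i' -> J i =1 J i' -> i = i') ->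
    \sum_(i | P i) f i *: Yprod A (fun l => e (J i l)) = 0 ->
  forall i, P i -> f i = 0.
Proof.
elim: n P J f => [|n IHn] P J f Jinj sum0 i Pi.
  (* There is only one empty tuple, so the relation is a single multiple of the nonzero vacuum. *)
  move: sum0; rewrite (bigD1 i) //= big1 ?addr0.
    by move/eqP; rewrite scaler_eq0 (negPf (vac_neq0 Virr)) orbF => /eqP.
  by move=> i' /andP[Pi' /eqP[]]; apply: Jinj => // -[].
(* Without this reduction the unification below takes minutes. *)
move: f sum0; cbn [itL itM Yprod] => f sum0.
have [d [_ dtr] de] := free_family_selector (J i ord0).
have hQ i' w : J i' ord0 == J i ord0 -> Y (d (e (J i' ord0))) w = lconst w.
  by move=> /eqP i'i; rewrite de i'i eqxx vertex_op_vac.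
have hnQ i' w : J i' ord0 != J i ord0 -> Y (d (e (J i' ord0))) w = 0.
  by move=> /negPf i'i; rewrite de i'i vertex_op0l.
have slice0 := @itmap_slice n (laurent F) V V (fun u => Y u) (fun u => Y (d u)) I P
  (fun i' => J i' ord0 == J i ord0) (fun i' => e (J i' ord0))
  (fun i' => Yprod A (fun l => e (J i' (fintype.lift ord0 l)))) f dtr hQ hnQ.
have {}slice0 := slice0 sum0.
(* It suffices to kill each coefficient of [f i] in the innermost variable; these coefficients occur
   in a relation of length [n]. *)
apply: (@itLmap_joint_inj n int _ _ (fun a => lcoef_at a)) => [c c0|a].
  by apply: lcoefP => a; apply: c0.
apply: (IHn (fun i' => P i' && (J i' ord0 == J i ord0))
  (fun i' l => J i' (fintype.lift ord0 l)) _ _ (slice0 a)); last by rewrite Pi eqxx.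
move=> i1 i2 /andP[Pi1 /eqP i1i] /andP[Pi2 /eqP i2i] i12; apply: Jinj => // l.
by have [l' ->|->] := unliftP ord0 l; rewrite ?i12 ?i1i ?i2i.
Qed.

End Independence.

(** * Translation and expansion of [F_*(x_1,...,x_n)] *)

Section FpsProduct.
Variables (R : comNzRingType).

(** The degree bounds carried by the index type of the Cauchy product are stripped, so that the
    product can be reindexed by a permutation. *)
Definition mnm_antidiag n (M : 'X_{1..n}) : seq ('X_{1..n} * 'X_{1..n}) :=
  [seq (bmnm k.1, bmnm k.2) |
    k : 'X_{1..n < (mdeg M).+1} * 'X_{1..n < (mdeg M).+1} <- index_enum _ & M == (k.1 + k.2)%MM].

Lemma mnm_antidiag_uniq n (M : 'X_{1..n}) : uniq (mnm_antidiag M).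
Proof.
rewrite map_inj_uniq ?filter_uniq ?index_enum_uniq //.
by move=> [a b] [a' b'] /= [] /val_inj -> /val_inj ->.
Qed.

Lemma mem_mnm_antidiag n (M : 'X_{1..n}) p : (p \in mnm_antidiag M) = (M == (p.1 + p.2)%MM).
Proof.
case: p => a b; apply/mapP/idP => [[k] /[!mem_filter] /andP[kM _] [-> ->] //|/eqP /= pM].
have d1 : (mdeg a < (mdeg M).+1)%N by rewrite pM ltnS mdegD leq_addr.
have d2 : (mdeg b < (mdeg M).+1)%N by rewrite pM ltnS mdegD leq_addl.
exists (BMultinom d1, BMultinom d2) => //.
by rewrite mem_filter mem_index_enum andbT /= -pM.
Qed.

Lemma fcoefM_antidiag n (f g : fps n R) M :
  (f * g) M = \sum_(p <- mnm_antidiag M) f p.1 * g p.2.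
Proof. by rewrite fcoefM big_map big_filter. Qed.

Definition fslice n (a : nat) (f : fps n.+1 R) : fps n R :=
  Fps (fun m => f [multinom of a :: m]).

Lemma mnm_cons_tail n (M : 'X_{1..n.+1}) : [multinom of M ord0 :: mnm_tail M] = M.
Proof.
apply/mnmP => i; rewrite (mnm_nth 0%N) /=.
have [j ->|->] := unliftP ord0 i => //=.
by rewrite -[RHS](mnmE (fun j => M (fintype.lift ord0 j))) (mnm_nth 0%N).
Qed.

Lemma mnm_cons_inj n a b (m m' : 'X_{1..n}) :
  [multinom of a :: m] = [multinom of b :: m'] -> a = b /\ m = m'.
Proof.
move=> E; have := congr1 (fun M : 'X_{1..n.+1} => M ord0) E.
rewrite !(mnm_nth 0%N) /=; split=> //.
by rewrite -(mnm_tail_cons a m) E mnm_tail_cons.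
Qed.

Lemma mnm_cons_add n a b (m m' : 'X_{1..n}) :
  ([multinom of a :: m] + [multinom of b :: m'])%MM = [multinom of (a + b)%N :: (m + m')%MM].
Proof.
apply/mnmP => i; rewrite mnmDE !(mnm_nth 0%N) /=.
have [j ->|->] := unliftP ord0 i => //=.
by rewrite -(mnm_nth 0%N (m + m')%MM) mnmDE !(mnm_nth 0%N).
Qed.

Definition mnm_pair_cons n (k a : nat) (p : 'X_{1..n} * 'X_{1..n}) :
    'X_{1..n.+1} * 'X_{1..n.+1} :=
  ([multinom of a :: p.1], [multinom of (k - a)%N :: p.2]).

Lemma mnm_antidiag_cons n k (m : 'X_{1..n}) :
  perm_eq (mnm_antidiag [multinom of k :: m])
    [seq mnm_pair_cons k a p | a <- index_iota 0 k.+1, p <- mnm_antidiag m].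
Proof.
apply: uniq_perm; first exact: mnm_antidiag_uniq.
  apply: allpairs_uniq; rewrite ?iota_uniq ?mnm_antidiag_uniq //.
  move=> [a [p1 p2]] [b [q1 q2]] _ _ E.
  have /mnm_cons_inj[/= -> ->] := congr1 fst E.
  by have /mnm_cons_inj[/= _ ->] := congr1 snd E.
move=> [p q]; rewrite mem_mnm_antidiag; apply/eqP/allpairsP => [/= E|].
  rewrite -(mnm_cons_tail p) -(mnm_cons_tail q) mnm_cons_add in E.
  have [-> ->] := mnm_cons_inj E; exists (p ord0, (mnm_tail p, mnm_tail q)).
  split; rewrite ?mem_index_iota ?ltnS ?leq_addr ?mem_mnm_antidiag //.
  by rewrite /mnm_pair_cons addKn !mnm_cons_tail.
move=> [[a [p' q']]] [+ + E].
have /= -> := congr1 fst E; have /= -> := congr1 snd E.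
rewrite mem_index_iota mem_mnm_antidiag ltnS /=.
by move=> ak /eqP ->; rewrite mnm_cons_add subnKC.
Qed.

(** Isolating the first variable serves twice: for t in the translation, and for x_1 in the passage
    to iterated Laurent series. *)
Lemma fcoefM_cons n (f g : fps n.+1 R) k (m : 'X_{1..n}) :
  (f * g) [multinom of k :: m] = \sum_(a < k.+1) (fslice a f * fslice (k - a)%N g) m.
Proof.
rewrite fcoefM_antidiag (perm_big _ (mnm_antidiag_cons k m)) big_allpairs_dep.
rewrite big_mkord; apply: eq_bigr => a _.
by rewrite fcoefM_antidiag.
Qed.

Definition fscale n (c : R) (f : fps n R) : fps n R := Fps (fun m => c * f m).

Lemma fscaleM n c c' (f g : fps n R) : fscale c f * fscale c' g = fscale (c * c') (f * g).
Proof.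
apply: fpsP => m; transitivity (c * c' * (f * g) m) => //.
rewrite !fcoefM_antidiag mulr_sumr.
by apply: eq_bigr => p _ /=; ring.
Qed.

(** Reduced to the Leibniz rule for polynomials by truncation. The truncation keeps degrees up to
    [mdeg m + 1], because a derivative reads one degree higher. *)
Lemma fps_derivM n i (f g : fps n R) :
  fps_deriv i (f * g) = fps_deriv i f * g + f * fps_deriv i g.
Proof.
apply: fpsP => m; rewrite fcoefD; transitivity ((f * g) (m + U_(i))%MM *+ (m i).+1) => //.
pose d := (mdeg m).+2; pose T := @fps_trunc n R d.
have md : (mdeg (m + U_(i))%MM < d)%N by rewrite mdegD mdeg1 addn1.
have dT h k : (mdeg k < (mdeg m).+1)%N -> ((T h)^`M(i))@_k = fps_deriv i h k.
  by move=> km; rewrite mcoeff_deriv fps_truncE // mdegD mdeg1 addn1.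
have TE h k : (mdeg k < (mdeg m).+1)%N -> (T h)@_k = h k.
  by move=> km; rewrite fps_truncE // ltnW.
rewrite [(f * g) _](fps_mulE _ _ md) -mcoeff_deriv mderivM mcoeffD.
rewrite ![(_ * _ : fps _ _) m](fps_mulE _ _ (ltnSn _)).
congr (_ + _); apply: (eq_mcoeffM (ltnSn (mdeg m))) => k km.
all: by rewrite (fps_truncE _ km) (dT, TE).
Qed.

End FpsProduct.

Lemma iter_leibniz (R : comNzRingType) (D : {additive R -> R}) :
    (forall f g, D (f * g) = D f * g + f * D g) -> forall k f g,
  iter k D (f * g) = \sum_(i < k.+1) (iter i D f * iter (k - i) D g) *+ 'C(k, i).
Proof.
move=> DM; elim=> [|k IHk] f g; first by rewrite big_ord1.
pose a i j := iter i D f * iter j D g.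
have -> : iter k.+1 D (f * g) = \sum_(i < k.+1) a i.+1 (k - i)%N *+ 'C(k, i) +
    \sum_(i < k.+1) a i (k - i).+1 *+ 'C(k, i).
  rewrite iterS IHk raddf_sum -big_split; apply: eq_bigr => i _.
  by rewrite raddfMn /= DM mulrnDl.
rewrite [RHS]big_ord_recl bin0 subn0.
under [X in _ = _ + X]eq_bigr => i _ do rewrite lift0 binS subSS mulrnDr.
rewrite big_split addrA [RHS]addrC; congr (_ + _).
rewrite [in RHS]big_ord_recr /= bin_small // mulr0n addr0.
rewrite big_ord_recl bin0 subn0; congr (_ + _).
by apply: eq_bigr => i _; rewrite lift0 subnSK.
Qed.

Section Series.
Variable K : fieldType.

Lemma lseriesM (u w : nat -> K) :
  lseries u * lseries w = lseries (fun k => \sum_(a < k.+1) u a * w (k - a)%N).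
Proof.
apply: lcoefP => k; rewrite (lcoefME (N := 0) (P := 0)); try by case.
case: k => [k|k]; rewrite !subr0.
  by apply: eq_bigr => a _; rewrite add0r subzn // -ltnS.
rewrite big1 // => a _; rewrite add0r.
rewrite (_ : Negz k - a%:Z = Negz (k + a)); last lia.
by rewrite /= mulr0.
Qed.

Lemma lseries_inj (u w : nat -> K) : lseries u = lseries w -> u =1 w.
Proof. by move=> uw k; have := congr1 (fun f : laurent K => f k%:Z) uw. Qed.

(** One step of the recursion of [fps_itL]: the first variable moves into the coefficient field, so
    facts about [fps_itL] follow by induction from facts about this map. *)
Definition fps_series n (g : fps n.+1 K) : fps n (laurent K) :=
  Fps (fun m => lseries (fun k => g [multinom of k :: m])).

Lemma fps_seriesM n (f g : fps n.+1 K) : fps_series (f * g) = fps_series f * fps_series g.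
Proof.
apply: fpsP => m; rewrite fcoefM_antidiag /=.
under eq_bigr do rewrite lseriesM.
apply: lcoefP => -[k|k]; rewrite lcoef_sum /=; last by rewrite big1.
rewrite [LHS](fcoefM_cons f g k m).
rewrite [RHS]exchange_big; apply: eq_bigr => a _.
by rewrite fcoefM_antidiag.
Qed.

Lemma fps_seriesB n (f g : fps n.+1 K) : fps_series (f - g) = fps_series f - fps_series g.
Proof.
apply: fpsP => m; rewrite fcoefD fcoefN; apply: lcoefP => -[k|k].
  by rewrite lcoefD lcoefN.
by rewrite lcoefD lcoefN subr0.
Qed.

Lemma fps_series_inj n : injective (@fps_series n).
Proof.
move=> f g fg; apply: fpsP => M; rewrite -(mnm_cons_tail M).
exact: (lseries_inj (congr1 (fun h : fps n (laurent K) => h (mnm_tail M)) fg)).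
Qed.

End Series.

Lemma fps_itL_is_additive n (K : fieldType) : zmod_morphism (fun g : fps n K => fps_itL g).
Proof.
elim: n K => [|n IHn] K f g //=.
by have := IHn _ (fps_series f) (fps_series g); rewrite -fps_seriesB.
Qed.

Lemma fps_itLM n (K : fieldType) (f g : fps n K) : fps_itL (f * g) = fps_itL f * fps_itL g.
Proof.
elim: n K f g => [|n IHn] K f g.
  transitivity ((f * g) 0%MM) => //; rewrite fcoefM_antidiag (perm_big [:: (0%MM, 0%MM)]).
    by rewrite big_seq1.
  apply: uniq_perm; rewrite ?mnm_antidiag_uniq // => -[p q].
  have mnm0 (m : 'X_{1..0}) : m = 0%MM by apply/mnmP => -[].
  by rewrite mem_mnm_antidiag (mnm0 p) (mnm0 q) !inE addm0 !eqxx.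
by have := IHn _ (fps_series f) (fps_series g); rewrite -fps_seriesM.
Qed.

Lemma fps_itL_inj n (K : fieldType) : injective (fun g : fps n K => fps_itL g).
Proof.
elim: n K => [|n IHn] K f g.
  move=> /= fg; apply: fpsP => m; suff -> : m = 0%MM by [].
  by apply/mnmP => -[].
by move=> fg; apply: fps_series_inj; apply: IHn.
Qed.

Lemma mnm_cons_eq0 n k (m : 'X_{1..n}) :
  ([multinom of k :: m] == 0%MM) = (k == 0%N) && (m == 0%MM).
Proof.
have E0 : 0%MM = [multinom of 0%N :: (0%MM : 'X_{1..n})].
  apply/mnmP => i; rewrite mnm0E (mnm_nth 0%N) /=.
  by have [j ->|->] := unliftP ord0 i; rewrite //= -(mnm_nth 0%N 0%MM) mnm0E.
apply/eqP/andP => [|[/eqP-> /eqP->]]; last by [].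
by rewrite E0 => /mnm_cons_inj[-> ->].
Qed.

Lemma fps_itLC n (K : fieldType) (c : K) : fps_itL (fpsC n c) = itC n K c.
Proof.
elim: n K c => [|n IHn] K c /=; first by rewrite eqxx.
rewrite -IHn; congr fps_itL; apply: funext => m; apply: lcoefP => -[k|k] /=.
  by rewrite mnm_cons_eq0; case: (m =P 0%MM); rewrite ?andbT ?andbF //=; case: k.
by case: eqP.
Qed.

Local Notation "x %:F" := (@FracField.tofrac _ x).

(** * Translation by t as an injective algebra morphism *)

Section Translate.
Variable F : fieldType.
Hypothesis char0 : [pchar F] =i pred0.

Lemma natf_fact_neq0 k : (k`!%:R : F) != 0.
Proof. by rewrite ((pcharf0P F).1 char0) -lt0n fact_gt0. Qed.

Lemma invf_fact_bin k i : (i <= k)%N ->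
  (k`!%:R^-1 : F) * 'C(k, i)%:R = i`!%:R^-1 * (k - i)`!%:R^-1.
Proof.
move=> ik; rewrite -(bin_fact ik) !natrM.
have C0 : ('C(k, i)%:R : F) != 0 by rewrite ((pcharf0P F).1 char0) -lt0n bin_gt0.
by field; rewrite C0 !natf_fact_neq0.
Qed.

Lemma fps_sum_deriv_is_additive n : zmod_morphism (@fps_sum_deriv n F).
Proof.
move=> f g; rewrite /fps_sum_deriv -sumrB; apply: eq_bigr => i _.
by apply: fpsP => m; rewrite fcoefD fcoefN /= mulrnBl.
Qed.
HB.instance Definition _ n := GRing.isZmodMorphism.Build (fps n F) (fps n F)
  (@fps_sum_deriv n F) (@fps_sum_deriv_is_additive n).

Lemma fps_sum_derivM n (f g : fps n F) :
  fps_sum_deriv (f * g) = fps_sum_deriv f * g + f * fps_sum_deriv g.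
Proof.
rewrite /fps_sum_deriv mulr_suml mulr_sumr -big_split; apply: eq_bigr => i _.
exact: fps_derivM.
Qed.

Lemma fps_translate_cons n (g : fps n F) k (m : 'X_{1..n}) :
  fps_translate g [multinom of k :: m] = k`!%:R^-1 * iter k (@fps_sum_deriv n F) g m.
Proof. by rewrite /= mnm_tail_cons (mnm_nth 0%N). Qed.

Lemma fslice_translate n (g : fps n F) k :
  fslice k (fps_translate g) = fscale k`!%:R^-1 (iter k (@fps_sum_deriv n F) g).
Proof. by apply: fpsP => m; apply: fps_translate_cons. Qed.

(** The exponential of t times a derivation is multiplicative: dividing the higher Leibniz rule by
    k! splits each binomial coefficient into two inverse factorials. *)
Lemma fps_translateM n (f g : fps n F) :
  fps_translate (f * g) = fps_translate f * fps_translate g.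
Proof.
apply: fpsP => M; rewrite -(mnm_cons_tail M); move: (M ord0) (mnm_tail M) => k m {M}.
rewrite fps_translate_cons fcoefM_cons (iter_leibniz (@fps_sum_derivM n)).
have -> (h : 'I_k.+1 -> fps n F) : (\sum_i h i) m = \sum_i h i m.
  by elim/big_rec2: _ => [|i y x _ <-]; first exact: fcoef0.
have fcoefMn (h : fps n F) c : (h *+ c) m = h m *+ c.
  by elim: c => [|c IHc]; rewrite ?mulr0n ?fcoef0 // !mulrS fcoefD IHc.
rewrite mulr_sumr; apply: eq_bigr => i _; rewrite !fslice_translate fscaleM fcoefMn.
transitivity ((i`!%:R^-1 * (k - i)`!%:R^-1) *
  (iter i (@fps_sum_deriv n F) f * iter (k - i) (@fps_sum_deriv n F) g) m) => //.
rewrite -(@invf_fact_bin k i); last by rewrite -ltnS.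
by rewrite -mulrA mulr_natl.
Qed.

Lemma fps_translateB n (f g : fps n F) :
  fps_translate (f - g) = fps_translate f - fps_translate g.
Proof.
apply: fpsP => M; rewrite fcoefD fcoefN /= -mulrBr; congr (_ * _).
elim: (M ord0) f g => // k IHk f g.
by rewrite !iterSr raddfB IHk.
Qed.

Lemma fps_translate_inj n : injective (@fps_translate n F).
Proof.
move=> f g fg; apply: fpsP => m.
have := congr1 (fun h : fps n.+1 F => h [multinom of 0%N :: m]) fg.
by rewrite !fps_translate_cons fact0 invr1 !mul1r.
Qed.

Lemma fps_translateC n (c : F) : fps_translate (fpsC n c) = fpsC n.+1 c.
Proof.
apply: fpsP => M; rewrite -(mnm_cons_tail M); move: (M ord0) (mnm_tail M) => k m {M}.
rewrite fps_translate_cons /= mnm_cons_eq0; case: k => [|k].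
  by rewrite fact0 invr1 mul1r.
rewrite iterSr; have -> : fps_sum_deriv (fpsC n c) = 0.
  apply: fpsP => m'; rewrite fps_sum_derivE fcoef0 big1 // => i _ /=.
  by rewrite mnmD_eq0 mnm1_eq0 andbF mul0rn.
rewrite /= (_ : iter k _ 0 = 0) ?fcoef0 ?mulr0 //.
by elim: k => // k IHk; rewrite iterS IHk raddf0.
Qed.

(** Cross-multiplication transfers along [fps_itL], which is multiplicative and injective. The
    denominator [b] may be any nonzero power series, so sums and products of fractions can be
    evaluated directly. *)
Lemma iota_E n (f : fstar n F) a b : b != 0 ->
  fstar_val f = a%:F / b%:F -> iota_ f = fps_itL a / fps_itL b.
Proof.
move=> b0; rewrite fstarE /iota_ => /eqP.
have d0 := fps_of_mpoly_neq0 (fstar_den_neq0 f).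
have itL0 (h : fps n F) : h != 0 -> fps_itL h != 0.
  apply: contraNneq => h0; apply/eqP/fps_itL_inj; rewrite h0.
  by have := fps_itL_is_additive (0 : fps n F) 0; rewrite !subrr.
rewrite eqr_div ?tofrac_eq0 //; last by rewrite -tofrac_eq0.
rewrite -!tofracM tofrac_eq => /eqP E; apply/eqP; rewrite eqr_div ?itL0 //.
  by rewrite -!fps_itLM E.
by rewrite -tofrac_eq0.
Qed.

(** The map g |-> g(t+x_1,...,t+x_n) on power series, expanded in iterated Laurent series; [psi] is
    its extension to fractions and gives the scalar factor in Z_n. *)
Definition fps_psi n (g : fps n F) : itL n (laurent F) := fps_itL (fps_translate g).
Definition psi n (f : fstar n F) : itL n (laurent F) := iota_ (fstar_translate f).

Lemma fps_psiB n : {morph @fps_psi n : f g / f - g}.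
Proof.
move=> f g; rewrite /fps_psi fps_translateB.
exact: (fps_itL_is_additive (fps_translate f) (fps_translate g)).
Qed.

Lemma fps_psi0 n : @fps_psi n 0 = 0.
Proof. by rewrite -(subrr 0) fps_psiB subrr. Qed.

Lemma fps_psiD n : {morph @fps_psi n : f g / f + g}.
Proof.
move=> f g; rewrite -[in LHS](opprK g) fps_psiB -[in LHS](add0r (- g)) fps_psiB.
by rewrite fps_psi0 add0r opprK.
Qed.

Lemma fps_psiM n : {morph @fps_psi n : f g / f * g}.
Proof.
move=> f g; rewrite /fps_psi fps_translateM.
exact: (fps_itLM (fps_translate f) (fps_translate g)).
Qed.

Lemma fps_psi_neq0 n (g : fps n F) : g != 0 -> fps_psi g != 0.
Proof.
apply: contraNneq => g0; apply/eqP/fps_translate_inj/(@fps_itL_inj n.+1 F).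
by rewrite -/(fps_psi g) g0 -fps_psi0.
Qed.

Lemma fps_psiC n c : @fps_psi n (fpsC n c) = itC n _ (lconst c).
Proof. by rewrite /fps_psi fps_translateC fps_itLC. Qed.

Lemma psiE n (f : fstar n F) a b : b != 0 ->
  fstar_val f = a%:F / b%:F -> psi f = fps_psi a / fps_psi b.
Proof.
move=> b0 fE; have d0 : fps_of_mpoly (fstar_den f) != 0.
  by rewrite -tofrac_eq0 fps_of_mpoly_neq0 ?fstar_den_neq0.
have -> : psi f = fps_psi (fstar_num f) / fps_psi (fps_of_mpoly (fstar_den f)).
  apply: (@iota_E n.+1 (fstar_translate f)) => //.
  have [q q0 ->] := fps_translate_poly (fstar_den_neq0 f).
  by rewrite -tofrac_eq0 fps_of_mpoly_neq0.
apply/eqP; rewrite eqr_div ?fps_psi_neq0 // -!fps_psiM; apply/eqP; congr fps_psi.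
apply/eqP; rewrite -tofrac_eq !tofracM -eqr_div ?tofrac_eq0 // -fE fstarE //.
Qed.

Lemma psi_ex n (f : fstar n F) : exists a b,
  [/\ b != 0, fstar_val f = a%:F / b%:F & psi f = fps_psi a / fps_psi b].
Proof.
exists (fstar_num f), (fps_of_mpoly (fstar_den f)).
have d0 : fps_of_mpoly (fstar_den f) != 0.
  by rewrite -tofrac_eq0 fps_of_mpoly_neq0 ?fstar_den_neq0.
by split=> //; [exact: fstarE|apply: psiE => //; exact: fstarE].
Qed.

Lemma psiD n : {morph @psi n : f g / f + g}.
Proof.
move=> f g; have [a [b [b0 fE ->]]] := psi_ex f; have [c [d [d0 gE ->]]] := psi_ex g.
rewrite (@psiE n (f + g) (a * d + c * b) (b * d)) ?mulf_neq0 //.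
  by rewrite addf_div ?fps_psi_neq0 // fps_psiD !fps_psiM.
by rewrite /= fE gE tofracD !tofracM addf_div ?tofrac_eq0.
Qed.

Lemma psiM n : {morph @psi n : f g / f * g}.
Proof.
move=> f g; have [a [b [b0 fE ->]]] := psi_ex f; have [c [d [d0 gE ->]]] := psi_ex g.
rewrite (@psiE n (f * g) (a * c) (b * d)) ?mulf_neq0 //.
  by rewrite mulf_div !fps_psiM.
by rewrite /= fE gE !tofracM mulf_div.
Qed.

Lemma psiC n c : psi (fstarC n c) = itC n _ (lconst c).
Proof.
have E1 : fps_of_mpoly 1 = fpsC n 1 :> fps n F := rmorph1 _.
have one0 : fpsC n 1 != 0 :> fps n F := oner_neq0 _.
rewrite (@psiE n _ (fpsC n c) (fpsC n 1)) //; last by rewrite -E1.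
by rewrite !fps_psiC (rmorph1 (@lconst F)) rmorph1 divr1.
Qed.

Lemma psi_eq0 n (f : fstar n F) : psi f = 0 -> f = 0.
Proof.
have [a [b [b0 fE ->]]] := psi_ex f => /eqP.
rewrite mulf_eq0 invr_eq0 (negPf (fps_psi_neq0 b0)) orbF => a0.
have {}a0 : a = 0 by apply/eqP; apply: contraTT a0 => /fps_psi_neq0.
by apply: val_inj; rewrite /= fE a0 tofrac0 mul0r.
Qed.

End Translate.

(* The inclusion of [K((x_i))] in [K((x_1))...((x_n))], with [i] counted    *)
(* from [0].                                                                *)
Fixpoint itpos (n i : nat) : forall K : fieldType, laurent K -> itL n K :=
  match n return forall K : fieldType, laurent K -> itL n K with
  | 0 => fun K c => 0
  | p.+1 => fun K c =>
      if i is j.+1 then @itpos p j (laurent K) (lmap (@lconst K) c) else itC p (laurent K) c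
  end.

Lemma itposM n i K : (i < n)%N -> {morph @itpos n i K : f g / f * g}.
Proof.
elim: n i K => [|n IHn] [|i] K //= ilt f g; first exact: rmorphM.
by rewrite -IHn // (@itLmapM 1 _ _ (@lconst K)) // => a b; apply: (rmorphM (@lconst K)).
Qed.

Lemma itLmap_itpos n i (K K' : fieldType) (s : {additive K -> K'}) c :
  itLmap n s (itpos n i c) = itpos n i (lmap s c).
Proof.
elim: n i K K' s c => [|n IHn] [|i] K K' s c /=; try exact: raddf0.
  exact: (itLmap_itC _ (lmap s)).
rewrite (IHn _ _ _ (lmap s)); congr itpos; apply: lcoefP => a; apply: lcoefP => b /=.
by case: eqP; rewrite ?raddf0.
Qed.

Lemma mnm_single_eq n (i : 'I_n) (m : 'X_{1..n}) :
  (m == (U_(i) *+ m i)%MM) = [forall j, (j != i) ==> (m j == 0%N)].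
Proof.
apply/eqP/forallP => [-> j|mi].
  by apply/implyP => ji; rewrite mulmnE mnm1E [i == j]eq_sym (negPf ji) mul0n.
apply/mnmP => j; rewrite mulmnE mnm1E; have := mi j.
by rewrite [i == j]eq_sym; case: eqVneq => [->|_ /= /eqP->]; rewrite ?mul1n ?mul0n.
Qed.

Lemma mnm_cons_ord0 n k (m : 'X_{1..n}) : [multinom of k :: m] ord0 = k.
Proof. by rewrite (mnm_nth 0%N). Qed.

Lemma mnm_cons_lift n k (m : 'X_{1..n}) j : [multinom of k :: m] (fintype.lift ord0 j) = m j.
Proof. by rewrite -[in RHS](mnm_tail_cons k m) mnmE. Qed.

Lemma fps_in_var_cons0 n (K : fieldType) (w : nat -> K) k (m : 'X_{1..n}) :
  fps_in_var ord0 w [multinom of k :: m] = if m == 0%MM then w k else 0.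
Proof.
rewrite /= mnm_single_eq mnm_cons_ord0; congr (if _ then _ else _).
apply/forallP/eqP => [H|-> j].
  apply/mnmP => j; have /implyP := H (fintype.lift ord0 j).
  by rewrite mnm_cons_lift mnm0E => /(_ isT) /eqP.
apply/implyP; have [j' ->|-> //] := unliftP ord0 j.
by rewrite mnm_cons_lift mnm0E.
Qed.

Lemma fps_in_var_cons n (K : fieldType) (i : 'I_n) (w : nat -> K) k (m : 'X_{1..n}) :
  fps_in_var (fintype.lift ord0 i) w [multinom of k :: m] =
  if k == 0%N then fps_in_var i w m else 0.
Proof.
rewrite /= !mnm_single_eq mnm_cons_lift.
transitivity (if (k == 0%N) && [forall j, (j != i) ==> (m j == 0%N)]
              then w (m i) else 0); last first.
  by case: eqP.
congr (if _ then _ else _).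
apply/forallP/andP => [H|[k0 /forallP H] j].
  split; first by have := H ord0; rewrite mnm_cons_ord0.
  apply/forallP => j; have := H (fintype.lift ord0 j).
  by rewrite mnm_cons_lift (inj_eq lift_inj).
have [j' ->|->] := unliftP ord0 j; last by rewrite mnm_cons_ord0.
by rewrite mnm_cons_lift (inj_eq lift_inj).
Qed.

Lemma fps_itL_in_var n (K : fieldType) (i : 'I_n) (w : nat -> K) :
  fps_itL (fps_in_var i w) = itpos n i (lseries w).
Proof.
elim: n K i w => [|n IHn] K i w; first by case: i.
have [j ->|->] := unliftP ord0 i.
  rewrite lift0 [RHS]/=.
  have -> : lmap (@lconst K) (lseries w) = lseries (fun k => lconst (w k)).
    by apply: lcoefP => -[k|k] //=; apply: raddf0.
  rewrite -IHn [LHS]/=; apply: (congr1 (@fps_itL n _)); apply: funext => m; apply: lcoefP => -[k|k].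
    rewrite [LHS](fps_in_var_cons j w k m) /=.
    by case: ifP => k0; case: ifP => // _; case: k k0.
  by rewrite /=; case: ifP.
rewrite [LHS]/= [RHS]/= -fps_itLC; apply: (congr1 (@fps_itL n _)).
apply: funext => m; apply: lcoefP => -[k|k].
  by rewrite [LHS](fps_in_var_cons0 w k m) /=; case: ifP.
by rewrite /=; case: ifP.
Qed.

(** * Functions of a single variable under translation *)

Section InVar.
Variable F : fieldType.
Hypothesis char0 : [pchar F] =i pred0.

Definition seq_deriv (u : nat -> F) (k : nat) : F := u k.+1 *+ k.+1.

Lemma fps_sum_deriv_in_var n (i : 'I_n) (u : nat -> F) :
  fps_sum_deriv (fps_in_var i u) = fps_in_var i (seq_deriv u).
Proof.
apply: fpsP => m; rewrite fps_sum_derivE (bigD1 i) //= big1 ?addr0 => [|j ji].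
  rewrite !mnm_single_eq mnmDE mnm1E eqxx addn1 /seq_deriv.
  have -> : [forall j, (j != i) ==> ((m + U_(i))%MM j == 0%N)] =
            [forall j, (j != i) ==> (m j == 0%N)].
    apply: eq_forallb => j; rewrite mnmDE mnm1E.
    by rewrite [i == j]eq_sym; case: eqVneq => //= _; rewrite addn0.
  by case: ifP => // _; rewrite mul0rn.
rewrite mnm_single_eq ifF ?mul0rn //; apply/negbTE/forallPn; exists j.
by rewrite ji mnmDE mnm1E eqxx addn1.
Qed.

Lemma iter_seq_deriv k (u : nat -> F) a :
  iter k seq_deriv u a *+ a`! = u (a + k)%N *+ (a + k)`!.
Proof.
elim: k u a => [|k IHk] u a; first by rewrite addn0.
by rewrite iterS /seq_deriv -mulrnA -factS IHk addSnnS.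
Qed.

(** Both sides equal binomial(a+k,k) u(a+k), the coefficient in u(t+x). This reconciles the
    expansion in powers of t used by [fps_translate] with the expansion in powers of x used by
    [ltaylor]. *)
Lemma seq_deriv_sym k (u : nat -> F) a :
  k`!%:R^-1 * iter k seq_deriv u a = a`!%:R^-1 * iter a seq_deriv u k.
Proof.
apply: (mulfI (natf_fact_neq0 char0 k)); rewrite mulVKf ?natf_fact_neq0 //.
apply: (mulfI (natf_fact_neq0 char0 a)); rewrite mulrCA mulVKf ?natf_fact_neq0 //.
by rewrite !mulr_natl !iter_seq_deriv addnC.
Qed.

Lemma lderiv_lseries (u : nat -> F) : lderiv (lseries u) = lseries (seq_deriv u).
Proof.
apply: lcoefP => n; rewrite -[LHS]/((n + 1)%:~R * lseries u (n + 1)).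
case: n => [k|[|k]].
- by rewrite (_ : k%:Z + 1 = k.+1%:Z); [exact: mulr_natl | lia].
- by rewrite (_ : Negz 0 + 1 = 0) // mul0r.
by rewrite (_ : Negz k.+1 + 1 = Negz k); [rewrite /= mulr0 | lia].
Qed.

Lemma ltaylor_lseries (u : nat -> F) :
  ltaylor (lseries u) = lseries (fun a => lseries (fun k => k`!%:R^-1 * iter k seq_deriv u a)).
Proof.
apply: lcoefP => -[a|a] //=.
have -> : iter a (@lderiv F) (lseries u) = lseries (iter a seq_deriv u).
  by elim: a => // a IHa; rewrite iterS IHa lderiv_lseries.
apply: lcoefP => k; rewrite [LHS](lconstZ (M := F^o)).
by case: k => [k|k] /=; rewrite ?scaler0 // [RHS]seq_deriv_sym.
Qed.

Lemma fps_psi_in_var n (i : 'I_n) (u : nat -> F) :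
  fps_psi (fps_in_var i u) = itpos n i (ltaylor (lseries u)).
Proof.
rewrite ltaylor_lseries -fps_itL_in_var /fps_psi [LHS]/=; apply: (congr1 (@fps_itL n _)).
apply: funext => m; apply: lcoefP => -[k|k].
  rewrite [LHS]fps_translate_cons /=.
  have -> : iter k (@fps_sum_deriv n F) (fps_in_var i u) = fps_in_var i (iter k seq_deriv u).
    by elim: k => // k IHk; rewrite iterS IHk fps_sum_deriv_in_var.
  by rewrite /=; case: ifP => // _; rewrite mulr0.
by rewrite /=; case: ifP.
Qed.

(** With numerator x_i^N h(x_i) and denominator x_i^N, the power series case settles both.
    Recombining them needs multiplicativity of the Taylor expansion, a hypothesis that [ltaylorM]
    provides. *)
Lemma psi_in_var n (i : 'I_n) (h : laurent F) :
    (forall f g : laurent F, ltaylor (f * g) = ltaylor f * ltaylor g) ->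
  psi (fstar_in_var i h) = itpos n i (ltaylor h).
Proof.
move=> taylorM; pose N := lpole h; pose u (k : nat) := h (k%:Z - N%:Z).
pose XN : fps n F := fps_of_mpoly ('X_i ^+ N).
have XN0 : XN != 0.
  by rewrite -tofrac_eq0; apply/fps_of_mpoly_neq0/mpolyXi_neq0.
have XNE : XN = fps_in_var i (fun k => (k == N)%:R).
  apply: fpsP => m; rewrite /= mpolyXn mcoeffX eq_sym.
  have [->|mN] := eqVneq m (U_(i) *+ N)%MM.
    by rewrite mulmnE mnm1E eqxx mul1n !eqxx.
  by case: eqP => // E; case: eqP => // mi; rewrite E mi eqxx in mN.
have -> : psi (fstar_in_var i h) = fps_psi (fps_in_var i u) / fps_psi XN.
  exact: psiE.
rewrite XNE !fps_psi_in_var.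
have hN : forall k : int, k < - N%:Z -> h k = 0.
  apply: (@xgetPex _ 0%N [set N : nat | forall k : int, k < - N%:Z -> h k = 0]%classic).
  by have [P hP] := lbound h; exists (absz P) => k kP; apply: hP; lia.
have -> : lseries u = h * lseries (fun k => (k == N)%:R).
  apply: lcoefP => k; rewrite [RHS]lmul_coef (@fsum_seq _ _ [:: k - N%:Z]) // ?big_seq1.
    rewrite subKr /= eqxx mulr1; case: k => [k|k] //=; rewrite hN //; lia.
  move=> j; rewrite inE => jk; case E: (k - j) => [a|a] /=; rewrite ?mulr0 //.
  case: eqP => [aN|_]; rewrite ?mulr0 //; case/eqP: jk; lia.
rewrite taylorM itposM // mulfK //.
by rewrite -fps_psi_in_var -XNE fps_psi_neq0.
Qed.

End InVar.

(** * The box tensor product *)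

Lemma itmap_lin n (K K' : fieldType) (M : lmodType K) (M' : lmodType K')
    (h h1 h2 : {additive M -> M'}) (c : K') :
    (forall w, h w = c *: h1 w + h2 w) -> forall X,
  @itmap n K K' M M' h X = itC n K' c *: itmap h1 X + itmap h2 X.
Proof.
elim: n K K' M M' h h1 h2 c => [|n IHn] K K' M M' h h1 h2 c hE //= X.
apply: (IHn _ _ (laurent M) (laurent M') (lmap h) (lmap h1) (lmap h2) (lconst c)) => w.
by apply: lcoefP => k; rewrite lcoefD lconstZ; apply: hE.
Qed.

Lemma itmap_semilin n (K K' : fieldType) (M : lmodType K) (M' : lmodType K')
    (h : {additive M -> M'}) (s : {additive K -> K'}) :
    (forall c w, h (c *: w) = s c *: h w) ->
  forall (f : itL n K) (X : itM n M), itmap h (f *: X) = itLmap n s f *: itmap h X.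
Proof.
move=> hs f X; rewrite -[X in LHS](@itmap_id n K M idfun) //.
exact: itmapZ.
Qed.

Lemma itmap_lin_arg n (K K' : fieldType) (M : lmodType K) (M' : lmodType K')
    (h : {additive M -> M'}) (s : {additive K -> K'}) (f : itL n K) f' (X X1 X2 : itM n M) :
    (forall c w, h (c *: w) = s c *: h w) -> itLmap n s f = f' ->
    X = f *: X1 + X2 ->
  itmap h X = f' *: itmap h X1 + itmap h X2.
Proof.
by move=> hs <- ->; rewrite -(itmap_semilin hs); apply: raddfD.
Qed.

Lemma itmap_scale n (K K' : fieldType) (M : lmodType K) (M' : lmodType K')
    (h h0 : {additive M -> M'}) (s : {additive K -> K'}) (c : K') (f : itL n K) f'
    (X X0 : itM n M) :
    (forall w, h w = c *: h0 w) ->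
    (forall c w, h0 (c *: w) = s c *: h0 w) -> itC n K' c * itLmap n s f = f' ->
    X = f *: X0 ->
  itmap h X = f' *: itmap h0 X0.
Proof.
move=> hh0 hs <- ->; rewrite -scalerA -(itmap_semilin hs).
rewrite (@itmap_lin n _ _ _ _ h h0 (GRing.null_fun M') c) => [|w]; last by rewrite hh0 addr0.
by rewrite [X in _ + X = _]itmap_eq0 ?addr0.
Qed.

(** Mirrors one step of [Yprod]: the scalar of the first slot comes out through [itC], while those
    of the other slots pass through Y(v_1,x_1) with coefficients made constant in x_1. *)
Lemma itpos_prod n (K : fieldType) (c : 'I_n.+1 -> laurent K) :
  itC n (laurent K) (c ord0) *
    itLmap n (@lconst K) (\prod_(i < n) itpos n i (c (fintype.lift ord0 i))) =
  \prod_(i < n.+1) itpos n.+1 i (c i).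
Proof.
rewrite big_ord_recl; congr (_ * _).
rewrite (big_morph (itLmap n (@lconst K)) (id1 := 1) (op1 := *%R)).
- by apply: eq_bigr => i _; rewrite itLmap_itpos lift0.
- by apply: itLmapM => a b; apply: (rmorphM (@lconst K)).
rewrite -(rmorph1 (itC n K)) itLmap_itC.
by have /= -> := rmorph1 (@lconst K); apply: rmorph1.
Qed.

(** * Multilinearity of iterated products *)

Section YprodLinear.
Variables (F : fieldType) (V : lmodType (laurent F)).
Variable A : nonlocal_vertex_Ft_algebra V.

Local Notation Y := (vertex_op A).
Local Notation vac := (nva_vac A : V).

(* Both sides act in the same way on [Y(1,x)1].                              *)
Lemma ltaylorM : vac != 0 -> {morph @ltaylor F : f g / f * g}.
Proof.
move=> vac0 f g; have := vertex_op_scalel A (f * g) vac vac.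
rewrite -scalerA !vertex_op_scalel scalerA => /eqP.
rewrite eq_sym -subr_eq0 -scalerBl scaler_eq0 subr_eq0 => /orP[/eqP //|].
rewrite vertex_op_vac => /eqP /(congr1 (fun m : laurent V => m 0)) /= /eqP.
by rewrite (negPf vac0).
Qed.

Lemma Yprod_lin n (i : 'I_n) (c : F) (v v1 v2 : 'I_n -> V) :
    v i = lconst c *: v1 i + v2 i ->
    (forall j, j != i -> v1 j = v j /\ v2 j = v j) ->
  Yprod A v = itC n (laurent F) (lconst c) *: Yprod A v1 + Yprod A v2.
Proof.
elim: n i v v1 v2 => [|n IHn] i v v1 v2; first by case: i.
have [j ->|->] := unliftP ord0 i => vi vj.
  have [v10 v20] := vj ord0 isT.
  have vE := IHn j (fun l => v (fintype.lift ord0 l)) (fun l => v1 (fintype.lift ord0 l))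
    (fun l => v2 (fintype.lift ord0 l)) vi.
  have {}vE := vE (fun l lj => vj (fintype.lift ord0 l) lj).
  rewrite /= v10 v20.
  apply: (itmap_lin_arg (s := @lconst (laurent F))) vE.
    by move=> c0 w; exact: (vertex_op_scaler A c0 (v ord0) w).
  exact: itLmap_itC.
have tailE (w : 'I_n.+1 -> V) : (forall j, j != ord0 -> w j = v j) ->
    (fun l : 'I_n => w (fintype.lift ord0 l)) = (fun l => v (fintype.lift ord0 l)).
  by move=> wv; apply: funext => l; apply: wv.
rewrite /= (tailE v1) => [|j /vj[]//]; rewrite (tailE v2) => [|j /vj[]//].
by apply: itmap_lin => w; rewrite vi; apply: vertex_op_linl.
Qed.

Lemma Yprod_scale n (h : 'I_n -> laurent F) (v : 'I_n -> V) :
  Yprod A (fun i => h i *: v i) = (\prod_(i < n) itpos n i (ltaylor (h i))) *: Yprod A v.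
Proof.
elim: n h v => [|n IHn] h v; first by rewrite big_ord0 scale1r.
have := itpos_prod (fun i => ltaylor (h i)).
move: (\prod_(i < n.+1) _); cbn [itL itM Yprod] => c cE.
apply: itmap_scale cE (IHn (fun l => h (fintype.lift ord0 l)) _).
  by move=> w; apply: vertex_op_scalel.
by move=> f w; exact: (vertex_op_scaler A f (v ord0) w).
Qed.

End YprodLinear.

Section FreegLift.
Variables (R : nzRingType) (K : choiceType) (M : lmodType R) (g : K -> M).

HB.instance Definition _ := GRing.isZmodMorphism.Build {freeg K / R} M (fglift g)
  (lift_is_additive g).

Lemma fglift_is_linear : linear (fglift g : {freeg K / R} -> M).
Proof.
move=> c D D'; rewrite raddfD; congr (_ + _).
rewrite [c *: D]/(fgscale c D) /fgscale -[in RHS](freeg_sumE D) !raddf_sum.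
by apply: eq_bigr => x _; rewrite /= !liftU scalerA.
Qed.
HB.instance Definition _ := GRing.isLinear.Build R {freeg K / R} M *:%R
  (fglift g : {freeg K / R} -> M) fglift_is_linear.

End FreegLift.

(** * Normal forms in the tensor product *)

Section BoxReduction.
Variables (F : fieldType) (V : lmodType (laurent F)) (n : nat).
Implicit Types (a b : box_free V n) (v : {ffun 'I_n -> overF V}) (f g : fstar n F).

Lemma box_relZ c a : box_rel a -> box_rel (c *: a).
Proof. by move=> ra; rewrite -[_ *: _]addr0; apply: box_relP => //; apply: box_rel0. Qed.

Lemma box_relD a b : box_rel a -> box_rel b -> box_rel (a + b).
Proof. by move=> ra rb; rewrite -[a]scale1r; apply: box_relP. Qed.

Lemma box_relN a : box_rel a -> box_rel (- a).
Proof. by rewrite -scaleN1r; apply: box_relZ. Qed.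

Lemma box_rel_sum I (s : seq I) (P : pred I) (E : I -> box_free V n) :
  (forall i, P i -> box_rel (E i)) -> box_rel (\sum_(i <- s | P i) E i).
Proof. by move=> rE; elim/big_ind: _ => //; [exact: box_rel0 | exact: box_relD]. Qed.

Lemma box_rel_trans b a c : box_rel (a - b) -> box_rel (b - c) -> box_rel (a - c).
Proof. by move=> ab bc; rewrite -(subrKA b); apply: box_relD. Qed.

Lemma box_rel_pure0 v : box_rel (box_pure v 0).
Proof.
have := box_linear_fun v (-1) 0 0.
by rewrite mulr0 addr0 scaleN1r addNr subr0.
Qed.

Lemma ffset_id v i u : v i = u -> ffset v i u = v.
Proof. by move=> vi; apply/ffunP => j; rewrite ffunE; case: eqP => [->|]. Qed.

Lemma box_rel_vect0 v i f : v i = 0 -> box_rel (box_pure v f).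
Proof.
move=> vi; have := box_linear_vect v i (-1) 0 0 f.
by rewrite scaler0 addr0 scaleN1r addNr subr0 ffset_id.
Qed.

Variables (m : nat) (e : 'I_m -> V).

Definition box_vect (J : {ffun 'I_n -> 'I_m}) : {ffun 'I_n -> overF V} :=
  [ffun i => e (J i) : overF V].

Definition box_repr a : Prop := exists f : {ffun 'I_n -> 'I_m} -> fstar n F,
  box_rel (a - \sum_J box_pure (box_vect J) (f J)).

Lemma box_repr_rel a b : box_rel (a - b) -> box_repr b -> box_repr a.
Proof. by move=> ab [f bf]; exists f; apply: box_rel_trans ab bf. Qed.

Lemma box_repr0 : box_repr 0.
Proof.
exists (fun=> 0); rewrite sub0r; apply/box_relN/box_rel_sum => J _.
exact: box_rel_pure0.
Qed.

Lemma box_repr_lin c a b : box_repr a -> box_repr b -> box_repr (c *: a + b).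
Proof.
move=> [f af] [g bg]; exists (fun J => fstarC n c * f J + g J).
apply: (box_rel_trans (b := c *: (\sum_J box_pure (box_vect J) (f J)) +
                            \sum_J box_pure (box_vect J) (g J))).
  by rewrite opprD addrACA -scalerBr; apply: box_relP.
rewrite scaler_sumr -big_split -sumrB; apply: box_rel_sum => J _.
by rewrite -opprB; apply/box_relN/box_linear_fun.
Qed.

Lemma box_repr_pure_vect J f : box_repr (box_pure (box_vect J) f).
Proof.
exists (fun J' => if J' == J then f else 0); rewrite (bigD1 J) //= eqxx opprD addNKr.
apply/box_relN/box_rel_sum => J' /negPf->; exact: box_rel_pure0.
Qed.

Definition in_span (u : V) : Prop := exists c : 'I_m -> laurent F, u = \sum_j c j *: e j.

(** The slots are expanded one at a time from the last: those below [k] still hold arbitrary vectors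
    of the span, those from [k] on hold single multiples of some [e j]. *)
Lemma box_repr_pure v f : (forall i, in_span (v i)) -> box_repr (box_pure v f).
Proof.
move=> vspan; suff H k (u : {ffun 'I_n -> overF V}) : (k <= n)%N ->
    (forall i : 'I_n, (i < k)%N -> in_span (u i)) ->
    (forall i : 'I_n, (k <= i)%N -> exists c, exists j, u i = (c *: e j : V)) ->
    box_repr (box_pure u f).
  by apply: (H n) => // i; rewrite leqNgt ltn_ord.
elim: k u {v vspan} => [|k IHk] v kn vlow vhigh.
  (* All slots are now single multiples, and [box_balance] moves all their scalars into the function
     at once. *)
  have [c cP] := fin_all_exists (fun i => vhigh i (leq0n i)).
  have [J JP] := fin_all_exists cP.
  have -> : v = [ffun i => c i *: (box_vect (finfun J) i : V) : overF V].
    by apply/ffunP => i; rewrite !ffunE JP.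
  apply: box_repr_rel (box_balance _ _ _) _; exact: box_repr_pure_vect.
pose i0 := Ordinal kn; have [c vi0] := vlow i0 (ltnSn k).
rewrite -(@ffset_id v i0 (\sum_(j <- index_enum 'I_m) c j *: e j : V)) //.
elim: (index_enum 'I_m) => [|j s IHs].
  rewrite big_nil -[box_pure _ _]subr0; apply: (@box_repr_rel _ 0).
    rewrite !subr0; apply: (@box_rel_vect0 _ i0); by rewrite ffunE eqxx.
  exact: box_repr0.
rewrite big_cons -[_ *: _ in X in _ i0 X]scale1r.
apply: box_repr_rel (box_linear_vect v i0 1 (c j *: e j : V) _ f) _.
apply: box_repr_lin IHs; apply: IHk; first exact: ltnW.
  move=> i ik; rewrite ffunE; case: eqP => [ii0|_]; last exact/vlow/ltnW.
  by move: ik; rewrite ii0 ltnn.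
move=> i ki; rewrite ffunE; case: eqP => [_|ii0]; first by exists (c j), j.
apply: vhigh; rewrite ltn_neqAle ki andbT; apply/eqP => ki'.
by apply: ii0; apply: val_inj.
Qed.

End BoxReduction.

(** Greedy choice: a vector joins the family, at index [ord0], only when it lies outside the span of
    the others. *)
Lemma free_span_extend (K : fieldType) (V : lmodType K) (s : seq V) :
  exists m, exists e : 'I_m -> V, free_family e /\
    forall v, v \in s -> exists c : 'I_m -> K, v = \sum_j c j *: e j.
Proof.
elim: s => [|v s [m [e [efree espan]]]].
  by exists 0%N, (fun _ => 0); split=> [c _ []|].
have [vspan|nvspan] := pselect (exists c : 'I_m -> K, v = \sum_j c j *: e j).
  by exists m, e; split=> // u; rewrite inE => /predU1P[->|/espan].
pose e' i := if unlift ord0 i is Some j then e j else v.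
have sumE (c : 'I_m.+1 -> K) :
    \sum_j c j *: e' j = c ord0 *: v + \sum_j c (fintype.lift ord0 j) *: e j.
  rewrite big_ord_recl /e' unlift_none; congr (_ + _).
  by apply: eq_bigr => j _; rewrite liftK.
exists m.+1, e'; split=> [c|u].
  rewrite sumE => c0; have c00 : c ord0 = 0.
    apply: contrapT => /eqP c0n; apply: nvspan.
    exists (fun j => - (c ord0)^-1 * c (fintype.lift ord0 j)).
    under eq_bigr do rewrite -scalerA.
    rewrite -scaler_sumr scaleNr; apply: (scalerI c0n); rewrite scalerN scalerA mulfV //.
    by rewrite scale1r; apply/eqP; rewrite -addr_eq0 c0.
  move: c0; rewrite c00 scale0r add0r => /efree c0 i.
  by have [j ->|->] := unliftP ord0 i.
rewrite inE => /predU1P[->|/espan [c ->]].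
  exists (fun j => (j == ord0)%:R); rewrite sumE eqxx scale1r big1 ?addr0 // => j _.
  by rewrite scale0r.
exists (fun i => if unlift ord0 i is Some j then c j else 0).
rewrite sumE unlift_none scale0r add0r; apply: eq_bigr => j _; by rewrite liftK.
Qed.

(** * Compatibility of Z_n with the defining relations *)

Section ZmapRel.
Variables (F : fieldType) (V : lmodType (laurent F)).
Variable A : nonlocal_vertex_Ft_algebra V.
Hypothesis char0 : [pchar F] =i pred0.
Hypothesis vac0 : (nva_vac A : V) != 0.
Variable n : nat.

Lemma Zmap_is_linear : linear (@Zmap F V A n).
Proof. exact: fglift_is_linear. Qed.

Lemma ZmapB : {morph @Zmap F V A n : a b / a - b}.
Proof. exact: lift_is_additive. Qed.

Lemma Zmap_pure v (f : fstar n F) : Zmap A (box_pure v f) = psi f *: Yprod A v.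
Proof. by rewrite /Zmap liftU scale1r. Qed.

Lemma Zmap_lin c a b :
  Zmap A (c *: a + b) = itC n (laurent F) (lconst c) *: Zmap A a + Zmap A b :> itM n V.
Proof. exact: Zmap_is_linear. Qed.

Lemma Zmap_sum I (s : seq I) (E : I -> box_free V n) :
  Zmap A (\sum_(i <- s) E i) = \sum_(i <- s) Zmap A (E i) :> itM n V.
Proof.
elim: s => [|i s IHs]; last first.
  by rewrite !big_cons -[E i]scale1r Zmap_lin !rmorph1 scale1r IHs scale1r.
rewrite !big_nil; by have := ZmapB 0 0; rewrite !subrr.
Qed.

Lemma psi_prod I (s : seq I) (E : I -> fstar n F) :
  psi (\prod_(i <- s) E i) = \prod_(i <- s) psi (E i).
Proof.
apply: big_morph; first exact: psiM.
have one_const : fstarC n 1 = 1 :> fstar n F.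
  apply: val_inj; rewrite /= (rmorph1 (@fps_of_mpoly n F)) -[fpsC n 1]/(1 : fps n F).
  by rewrite !tofrac1 divr1.
by rewrite -one_const psiC // (rmorph1 (@lconst F)) rmorph1.
Qed.

(** The essential case is balancing: h(t) in slot i comes out of Y as h(t+x_i) by [Yprod_scale], and
    [psi] turns h(x_i) into the same series by [psi_in_var]. *)
Lemma Zmap_box_rel (a : box_free V n) : box_rel a -> Zmap A a = 0.
Proof.
elim=> {a} [v i c a b f|v c f g|v h f||c a b _ a0 _ b0].
- rewrite ZmapB Zmap_lin !Zmap_pure; apply/eqP; rewrite subr_eq0; apply/eqP.
  rewrite (Yprod_lin A (i := i) (c := c) (v1 := ffset v i a) (v2 := ffset v i b)).
  + by rewrite scalerDr !scalerA mulrC.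
  + by rewrite !ffunE eqxx.
  by move=> j /negPf ji; rewrite !ffunE ji.
- rewrite ZmapB Zmap_lin !Zmap_pure psiD // psiM // psiC //.
  by rewrite scalerDl scalerA subrr.
- rewrite ZmapB !Zmap_pure psiM // psi_prod.
  have -> : Yprod A [ffun i => h i *: (v i : V) : overF V] = Yprod A (fun i => h i *: (v i : V)).
    by congr Yprod; apply: funext => i; rewrite ffunE.
  rewrite Yprod_scale scalerA.
  have -> : \prod_(i < n) psi (fstar_in_var i (h i)) = \prod_(i < n) itpos n i (ltaylor (h i)).
    by apply: eq_bigr => i _; rewrite psi_in_var //; apply: (ltaylorM vac0).
  by rewrite mulrC; apply: subrr.
- by have := ZmapB 0 0; rewrite !subrr.
by rewrite Zmap_lin a0 b0 scaler0 addr0.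
Qed.

End ZmapRel.

Theorem proposition3p6 (F : fieldType) (V : lmodType (laurent F))
    (A : nonlocal_vertex_Ft_algebra V) :
  [pchar F] =i pred0 ->
  nva_irreducible A ->
  nva_End_eq_Ft A ->
  nva_nondegenerate A.
Proof.
move=> char0 Virr VEnd n _ a b ab; apply/eqP; rewrite -Quotient.idealrBE.
apply/asboolP; have vac0 := vac_neq0 Virr.
have {ab} Zab : Zmap A (a - b) = 0 by rewrite ZmapB ab subrr.
move: (a - b) Zab => {a b} a Za.
pose vects (x : box_gen V n) : seq V := [seq (x.1 i : V) | i <- enum 'I_n].
(* The family spans, over F((t)), every vector in a tensor of the support of [a]. *)
have [m [e [efree espan]]] := free_span_extend (flatten [seq vects x | x <- dom a]).
have [f af] : box_repr e a.
  have: {subset dom a <= dom a} by [].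
  rewrite -[X in box_repr _ X](freeg_sumE a); elim: {-2}(dom a) => [|x r IHr] rs.
    rewrite big_nil; exact: box_repr0.
  rewrite big_cons.
  have -> : << coeff x a *g x >> = coeff x a *: (box_pure x.1 x.2 : box_free V n).
    rewrite /box_pure -surjective_pairing; apply/eqP/freeg_eqP => y.
    by rewrite coeffZ !coeffU mul1r.
  apply: box_repr_lin; last by apply: IHr => y yr; apply: rs; rewrite inE yr orbT.
  apply: box_repr_pure => i; apply: espan; apply/flattenP.
  exists (vects x); last by apply: (map_f (fun i => x.1 i : V)); rewrite mem_enum.
  by apply: map_f; apply: rs; rewrite inE eqxx.
(* The normal form is congruent to [a], so its image is zero too. *)
have Z0 : \sum_J psi (f J) *: Yprod A (fun i => e (J i)) = 0.
  have := Zmap_box_rel char0 vac0 af; rewrite ZmapB Za sub0r => /eqP.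
  rewrite oppr_eq0 Zmap_sum => /eqP E; apply: etrans E; apply: eq_bigr => J _.
  rewrite Zmap_pure; congr (_ *: Yprod _ _); apply: funext => i; by rewrite ffunE.
have f0 J : f J = 0.
  apply: (psi_eq0 char0).
  apply: (Yprod_independent Virr VEnd efree (P := xpredT)
    (J := fun (J : {ffun 'I_n -> 'I_m}) i => J i) (f := fun J => psi (f J))) => //.
  by move=> J1 J2 _ _ /ffunP.
rewrite -[a](subrK (\sum_J box_pure (box_vect e J) (f J))); apply: box_relD => //.
by apply: box_rel_sum => J _; rewrite f0; apply: box_rel_pure0.
Qed.
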